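(* Let $n\ge 2$, $s\in(0,1)$, and let $\omega\subseteq\mathbb{R}^n$ be a bounded open set such that $\Omega:=\omega\times\mathbb{R}\subseteq\mathbb{R}^{n+1}$ has Lipschitz boundary. Write points of $\mathbb{R}^{n+1}$ as $X=(x',x_n,x_{n+1})\in\mathbb{R}^{n-1}\times\mathbb{R}\times\mathbb{R}$. Suppose that there exist $\rho>0$ and $\varphi:\mathbb{R}^{n-1}\to[0,+\infty)$ with $\varphi(0)=0$ and $$\varphi(x')\ge c|x'|^\beta\quad\text{for all }x'\in\mathbb{R}^{n-1}\text{ with }|x'|<\rho,$$ for some $c>0$ and $\beta\in(0,s+1]$, and such that $$\omega\cap B_\rho=\{x_n>\varphi(x')\}\cap B_\rho .$$ Assume that $E_0=\{x_{n+1}<\psi(x',x_n)\}$ for some $\psi\in L^\infty_{\rm loc}(\mathbb{R}^n)$ such that $\psi(x',x_n)\le 0$ for all $(x',x_n)\in B_\rho$. Let $E$ be an $s$-minimal set in $\Omega$ with $E\setminus\Omega=E_0\setminus\Omega$. Then for every $\varepsilon>0$ there exists $\delta>0$ such that $$E\cap C_\delta\subseteq\{x_{n+1}\le\varepsilon\}.$$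
   Context: For $s\in(0,1)$ and measurable $A,B\subseteq\mathbb{R}^{n+1}$, $L_s(A,B):=\iint_{A\times B}|x-y|^{-(n+1+s)}\,dx\,dy$. For an open set $U\subseteq\mathbb{R}^{n+1}$ and $E\subseteq\mathbb{R}^{n+1}$, the $s$-perimeter is $\operatorname{Per}_s(E,U):=L_s(E\cap U,E^c\cap U)+L_s(E\cap U,E^c\cap U^c)+L_s(E\cap U^c,E^c\cap U)$, where superscript $c$ denotes complement in $\mathbb{R}^{n+1}$. If $U$ is bounded, $E$ is $s$-minimal in $U$ if $\operatorname{Per}_s(E,U)<+\infty$ and $\operatorname{Per}_s(E,U)\le\operatorname{Per}_s(F,U)$ for all $F$ with $E\setminus U=F\setminus U$. For the unbounded cylinder $\Omega=\omega\times\mathbb{R}$, $E$ is $s$-minimal in $\Omega$ if it is $s$-minimal in every bounded open set $\Omega'\subseteq\Omega$. $B_\rho$ denotes the ball $\{x\in\mathbb{R}^n:|x|<\rho\}$ (identified with $B_\rho\times\{0\}$), and $C_\delta:=B_\delta\times\mathbb{R}\subseteq\mathbb{R}^{n+1}$.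
   Formalization: E is additionally assumed normalized: for every point X of E in Ω and every r>0, the intersection of E with the ball of radius r about X has positive measure; otherwise adding a null set of high points near the axis to E would falsify the claim. *)

(* Defs.v *)
From HB Require Import structures.
From mathcomp Require Import all_boot all_order all_algebra.
From mathcomp Require Import all_classical all_reals all_analysis.
Set Implicit Arguments. Unset Strict Implicit. Unset Printing Implicit Defensive.
Import Order.TTheory GRing.Theory Num.Theory.
Local Open Scope classical_set_scope.
Local Open Scope ring_scope.

Section Defs.
Variable R : realType.

(* Euclidean norm on R^m (the library norm on matrices is the sup norm). *)
Definition enorm (m : nat) (x : 'rV[R]_m) : R :=
  Num.sqrt (\sum_(i < m) x ord0 i ^+ 2).

Definition eball (m : nat) (p : 'rV[R]_m) (r : R) : set 'rV[R]_m :=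
  [set x | enorm (x - p) < r].

Definition eopen (m : nat) (U : set 'rV[R]_m) : Prop :=
  forall x, U x -> exists2 r : R, 0 < r & eball x r `<=` U.

Definition ebounded (m : nat) (U : set 'rV[R]_m) : Prop :=
  exists M : R, forall x, U x -> enorm x < M.

Definition borel (m : nat) (A : set 'rV[R]_m) : Prop :=
  <<s [set U : set 'rV[R]_m | eopen U] >> A.

(* Iterated one-dimensional Lebesgue integrals over R^m
   (for nonnegative Borel integrands this is the Lebesgue integral on R^m,
   by Tonelli).  A point of R^(m+1) is written as (t, x) with t : R. *)
Fixpoint iint (m : nat) : ('rV[R]_m -> \bar R) -> \bar R :=
  match m return ('rV[R]_m -> \bar R) -> \bar R with
  | 0%N => fun f => f 0
  | m'.+1 => fun f =>
      (\int[@lebesgue_measure R]_(t in [set: R])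
          iint (fun x : 'rV[R]_m' => f (row_mx (t%:M : 'rV[R]_1) x)))%E
  end.

Definition vol (m : nat) (A : set 'rV[R]_m) : \bar R :=
  iint (fun x => (\1_A x)%:E).

Definition lnull (m : nat) (N : set 'rV[R]_m) : Prop :=
  exists M, [/\ borel M, vol M = 0%E & N `<=` M].

Definition lmeasurable (m : nat) (A : set 'rV[R]_m) : Prop :=
  exists B, borel B /\ lnull ((A `\` B) `|` (B `\` A)).

Definition Ls (m : nat) (s : R) (A B : set 'rV[R]_m) : \bar R :=
  iint (fun x => iint (fun y =>
    (\1_A x * \1_B y * (enorm (x - y)) `^ (- (m%:R + s)))%:E)).

Definition Per_borel (m : nat) (s : R) (E U : set 'rV[R]_m) : \bar R :=
  (Ls s (E `&` U) (~` E `&` U) + Ls s (E `&` U) (~` E `&` ~` U)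
   + Ls s (E `&` ~` U) (~` E `&` U))%E.

(* s-perimeter of a Lebesgue measurable set: computed on any Borel set
   a.e. equal to it (the value does not depend on the representative). *)
Definition Per (m : nat) (s : R) (E U : set 'rV[R]_m) : \bar R :=
  ereal_inf [set Per_borel s B U | B in
     [set B | borel B /\ lnull ((E `\` B) `|` (B `\` E))]].

Definition s_minimal_bdd (m : nat) (s : R) (E U : set 'rV[R]_m) : Prop :=
  [/\ lmeasurable E, (Per s E U < +oo)%E &
      forall F, lmeasurable F -> E `\` U = F `\` U -> (Per s E U <= Per s F U)%E].

Definition s_minimal (m : nat) (s : R) (E O : set 'rV[R]_m) : Prop :=
  forall O', eopen O' -> ebounded O' -> O' `<=` O -> s_minimal_bdd s E O'.

Definition lipschitz_fun (m : nat) (g : 'rV[R]_m -> R) : Prop :=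
  exists L : R, forall a b, `|g a - g b| <= L * enorm (a - b).

Definition first_coords (m : nat) (Y : 'rV[R]_m.+1) : 'rV[R]_m :=
  \row_(i < m) Y ord0 (widen_ord (leqnSn m) i).

Definition last_coord (m : nat) (Y : 'rV[R]_m.+1) : R := Y ord0 ord_max.

Definition lipschitz_boundary (m : nat) (U : set 'rV[R]_m.+1) : Prop :=
  forall p, ~ U p -> (forall r : R, 0 < r -> exists y, U y /\ enorm (y - p) < r) ->
    exists r : R, exists Q : 'M[R]_m.+1, exists g : 'rV[R]_m -> R,
      [/\ 0 < r, Q *m Q^T = 1%:M, lipschitz_fun g &
          forall X, enorm (X - p) < r ->
            (U X <-> g (first_coords ((X - p) *m Q)) < last_coord ((X - p) *m Q))].

Definition xprime (n : nat) (x : 'rV[R]_n) : 'rV[R]_n.-1 :=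
  \row_(i < n.-1) x ord0 (widen_ord (leq_pred n) i).
Definition xn (n : nat) : 'rV[R]_n -> R :=
  match n return 'rV[R]_n -> R with
  | 0%N => fun _ => 0
  | n'.+1 => fun x => x ord0 ord_max
  end.

Definition Linfty_loc (n : nat) (psi : 'rV[R]_n -> R) : Prop :=
  (forall a : R, lmeasurable [set x | psi x < a]) /\
  (forall r : R, 0 < r -> exists M : R,
     lnull [set x | enorm x < r /\ M < `|psi x|]).

End Defs.

(* Main.v *)
Require Import Defs.
From HB Require Import structures.
From mathcomp Require Import all_boot all_order all_algebra.
From mathcomp Require Import all_classical all_reals all_analysis.
From mathcomp Require Import measurable_realfun ring lra.
Import Order.TTheory GRing.Theory Num.Theory.
Local Open Scope classical_set_scope.
Local Open Scope ring_scope.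

(* Fix a height [h > eps] and put [X0 = (0, 0, h)].  The part [P] of the
   complement of the cylinder lying over [B_rho] and above height [0] does not
   meet [E]; near [X0] it contains [{x_n < c |x'|^(1+s)}] since
   [beta <= 1 + s].  Consider the sets [P `|` {x_n + |x - X0|^2 < t}] for small
   [t > 0].  The paraboloid-like leaf has nonlocal mean curvature bounded
   independently of [t], while the region between [{x_n = t}] and the graph of
   [c |x'|^(1+s)], counted with the kernel, has a mass which diverges as
   [t -> 0], because [1 + s] is the critical exponent.  Hence all leaves with
   [t] small, uniformly in [h], have a strict sign of curvature, and a
   calibration argument (the relation "[y] lies on a lower leaf than [x]" being
   antisymmetric) shows that deleting from [E] the points of low level strictly
   decreases the perimeter unless they form a null set.  Since points of [E]
   have positive density, [E] has no point at height [h] near the axis.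
   The kernel is truncated at level [N] to avoid principal values, and
   [N -> oo] at the end. *)

(** With the full kernel, both sides of the curvature inequality at a point of a leaf are infinite,
    so the comparison has to be made with truncated kernels, by constants that do not see the
    truncation. For this reason [balanced] quantifies over all even kernels squeezed between
    [Num.min (riesz s z) M] and [riesz s z], where [M] depends on the gain boxes only. The level
    [N >= M] is sent to infinity after integration over the deleted set, where the self-interaction
    has already been cancelled.

    The set [E] is only Lebesgue measurable and [Per] is an infimum over Borel representatives,
    whereas antisymmetry of the calibrating relation is needed pointwise. The argument therefore
    runs on a Borel representative from which [P] has been removed.

    Uniformity in the height comes from translation invariance: the threshold [d0], the level [M]
    and the gain set [Q] are found relative to the origin, before any point of [E] is chosen, and
    only then moved to [X0]. *)

Set Implicit Arguments. Unset Strict Implicit. Unset Printing Implicit Defensive.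

(** * Euclidean norm and Lebesgue measure on row vectors *)

Section EuclideanNorm.
Variables (R : realType) (m : nat).
Implicit Types x y z : 'rV[R]_m.

Lemma enorm_ge0 x : 0 <= enorm x.
Proof. exact: sqrtr_ge0. Qed.

Lemma enormE x : enorm x ^+ 2 = \sum_(i < m) x ord0 i ^+ 2.
Proof. by rewrite sqr_sqrtr// sumr_ge0// => i _; exact: sqr_ge0. Qed.

Lemma coord_enorm x i : `|x ord0 i| <= enorm x.
Proof.
rewrite -(@ler_pXn2r _ 2)// ?nnegrE ?enorm_ge0// enormE (bigD1 i)//=.
by rewrite real_normK ?num_real// lerDl sumr_ge0// => j _; exact: sqr_ge0.
Qed.

Lemma enorm_le_sum x : enorm x <= \sum_(i < m) `|x ord0 i|.
Proof.
rewrite -(@ler_pXn2r _ 2)// ?nnegrE ?enorm_ge0 ?sumr_ge0// enormE.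
suff [] : \sum_(i < m) x ord0 i ^+ 2 <= (\sum_(i < m) `|x ord0 i|) ^+ 2 /\
  0 <= \sum_(i < m) `|x ord0 i| by [].
elim/big_rec2 : _ => [|i a b _ [ab a0]]; first by rewrite expr0n.
have := normr_ge0 (x ord0 i); rewrite -(real_normK (num_real (x ord0 i))).
by move: `|_| => c c0; split; nra.
Qed.

Lemma enorm_lt_coord x r : (forall i, `|x ord0 i| < r) -> 0 < r ->
  enorm x <= m%:R * r.
Proof.
move=> xr r0; apply: le_trans (enorm_le_sum x) _.
apply: (@le_trans _ _ (\sum_(i < m) r)); first by apply: ler_sum => i _; exact: ltW.
by rewrite sumr_const card_ord mulr_natl.
Qed.

Lemma enormN x : enorm (- x) = enorm x.
Proof. by congr Num.sqrt; apply: eq_bigr => i _; rewrite mxE sqrrN. Qed.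

Lemma enormB x y : enorm (x - y) = enorm (y - x).
Proof. by rewrite -enormN opprB. Qed.

Lemma enorm0 : enorm (0 : 'rV[R]_m) = 0.
Proof.
by rewrite /enorm big1 ?sqrtr0// => i _; rewrite mxE expr0n.
Qed.

Lemma enormD x y : enorm (x + y) <= enorm x + enorm y.
Proof.
have := enorm_ge0 x; have := enorm_ge0 y.
set a := enorm x; set b := enorm y => b0 a0.
rewrite -(@ler_pXn2r _ 2)// ?nnegrE ?enorm_ge0 ?addr_ge0//.
have -> : enorm (x + y) ^+ 2 =
    a ^+ 2 + b ^+ 2 + 2 * \sum_(i < m) x ord0 i * y ord0 i.
  rewrite !enormE mulr_sumr -!big_split/=.
  by apply: eq_bigr => i _; rewrite mxE; ring.
suff : \sum_(i < m) x ord0 i * y ord0 i <= a * b by nra.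
have [a0'|aN0] := eqVneq a 0.
  rewrite big1 ?a0' ?mul0r// => i _.
  suff -> : x ord0 i = 0 by rewrite mul0r.
  by apply/normr0_eq0/le_anti; rewrite normr_ge0 -a0' coord_enorm.
have [b0'|bN0] := eqVneq b 0.
  rewrite big1 ?b0' ?mulr0// => i _.
  suff -> : y ord0 i = 0 by rewrite mulr0.
  by apply/normr0_eq0/le_anti; rewrite normr_ge0 -b0' coord_enorm.
have ap : 0 < a by rewrite lt_def aN0.
have bp : 0 < b by rewrite lt_def bN0.
have : 0 <= \sum_(i < m) (b * x ord0 i - a * y ord0 i) ^+ 2.
  by apply: sumr_ge0 => i _; exact: sqr_ge0.
have -> : \sum_(i < m) (b * x ord0 i - a * y ord0 i) ^+ 2 =
    b ^+ 2 * a ^+ 2 + a ^+ 2 * b ^+ 2 -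
    2 * a * b * \sum_(i < m) x ord0 i * y ord0 i.
  transitivity (b ^+ 2 * (\sum_(i < m) x ord0 i ^+ 2) +
      a ^+ 2 * (\sum_(i < m) y ord0 i ^+ 2) -
      2 * a * b * \sum_(i < m) x ord0 i * y ord0 i); last by rewrite -!enormE.
  rewrite !mulr_sumr -big_split -sumrB/=.
  by apply: eq_bigr => i _; ring.
set S := \sum_(i < m) _ => h.
have ab : 0 < a * b by rewrite mulr_gt0.
rewrite -(ler_pM2l ab); nra.
Qed.

Lemma open_eball (p : 'rV[R]_m) r : eopen (eball p r).
Proof.
move=> x; rewrite /eball/= => xr; exists (r - enorm (x - p)); first by rewrite subr_gt0.
move=> y; rewrite /eball/= => yx.
have := enormD (y - x) (x - p); rewrite addrA subrK; lra.
Qed.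

Lemma eopenI (U V : set 'rV[R]_m) : eopen U -> eopen V -> eopen (U `&` V).
Proof.
move=> oU oV x [/oU[r r0 rU] /oV[q q0 qV]]; exists (Num.min r q).
  by rewrite lt_min r0.
move=> y; rewrite /eball/= lt_min => /andP[yr yq]; split; [exact: rU|exact: qV].
Qed.

End EuclideanNorm.

(* [g_sigma_algebraType] requires a pointed carrier, which ['rV[R]_m] is not
   canonically: hence the alias [rowpt]. *)
Definition rowpt (R : realType) (m : nat) : Type := 'rV[R]_m.
HB.instance Definition _ R m := Choice.on (rowpt R m).
HB.instance Definition _ R m := isPointed.Build (rowpt R m) (0 : 'rV[R]_m).
Definition eopens (R : realType) (m : nat) : set (set (rowpt R m)) :=
  [set U | eopen U].
Notation rowspace R m := (g_sigma_algebraType (@eopens R m)).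

(** * Borel sets of row vectors *)

Section BorelRow.
Variable R : realType.

Lemma measurable_ltr_set d (T : measurableType d) (f g : T -> R) :
  measurable_fun setT f -> measurable_fun setT g -> measurable [set t | f t < g t].
Proof.
move=> mf mg; have := measurable_fun_ltr mf mg.
by move=> /(_ measurableT [set true]); rewrite setTI; exact.
Qed.

Lemma eopen_measurable m (U : set 'rV[R]_m) :
  eopen U -> measurable (U : set (rowspace R m)).
Proof. by move=> oU; exact: sub_sigma_algebra. Qed.

Lemma eopen_coord_gt m (i : 'I_m) (a : R) : eopen [set x : 'rV[R]_m | a < x ord0 i].
Proof.
move=> x/= ax; exists (x ord0 i - a); first by rewrite subr_gt0.
move=> y; rewrite /eball/= => h; have := le_lt_trans (coord_enorm (y - x) i) h.
by rewrite !mxE ltr_norml => /andP[]; lra.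
Qed.

Lemma measurable_coord m (i : 'I_m) :
  measurable_fun [set: rowspace R m] (fun x : rowspace R m => (x : 'rV[R]_m) ord0 i).
Proof.
move=> mD; apply: (measurability _ (RGenOInfty.measurableE R)) => // _ [_ [a ->] <-].
rewrite setTI; have -> : (fun x : rowspace R m => (x : 'rV[R]_m) ord0 i) @^-1` `]a, +oo[ =
   [set x : 'rV[R]_m | a < x ord0 i].
  by apply/seteqP; split => x/=; rewrite in_itv/= andbT.
by apply: eopen_measurable; exact: eopen_coord_gt.
Qed.

(** The sigma-algebra is generated by Euclidean open sets, not by coordinates. An open set is the
    countable union of the rational boxes it contains, and the preimage of a box is a finite
    intersection of conditions on coordinates. *)
Lemma measurable_row d (T : measurableType d) m (f : T -> rowspace R m) :
  (forall i, measurable_fun setT (fun t => (f t : 'rV[R]_m) ord0 i)) ->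
  measurable_fun setT f.
Proof.
move=> mf.
apply: (@measurability _ _ _ (rowspace R m) setT f (@eopens R m) erefl).
move=> _ [U oU <-]; rewrite setTI.
pose box (qk : 'rV[rat]_m * nat) : set 'rV[R]_m :=
  [set x | forall i, `|x ord0 i - ratr (qk.1 ord0 i)| < qk.2.+1%:R^-1].
have -> : f @^-1` U = \bigcup_qk (if `[< box qk `<=` U >] then f @^-1` box qk else set0).
  apply/seteqP; split => [t/= Ut|t [qk _]]; last by case: asboolP => // + ?; exact.
  have [r r0 rU] := oU _ Ut.
  (* Two points of a box of half-width [w] differ by less than [2 * w] in each coordinate, so their
     distance is at most [m * (2 * w)]; this choice of [k] makes it smaller than [r]. *)
  have [k kr] : exists k : nat, (2 * m.+1%:R) / r < k.+1%:R.
    by exists (Num.truncn ((2 * m.+1%:R) / r)); exact: truncnS_gt.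
  have [w wE k0] : exists2 w : R, w = k.+1%:R^-1 & 0 < w.
    by exists k.+1%:R^-1; rewrite ?invr_gt0.
  have /(_ _)/cid qP : forall i, exists q : rat, `|(f t : 'rV[R]_m) ord0 i - ratr q| < w.
    move=> i; set u := (f t : 'rV[R]_m) ord0 i.
    have /rat_in_itvoo[q] : u < u + w by rewrite ltrDl.
    by rewrite in_itv/= => /andP[h1 h2]; exists q; rewrite ltr_norml; apply/andP; split; lra.
  exists (\row_i sval (qP i), k) => //.
  case: asboolP => [_ i /=|]; first by rewrite mxE -wE; exact: (svalP (qP i)).
  case=> y yb; apply: rU; rewrite /eball/=.
  have h i : `|(y - f t) ord0 i| < 2 * w.
    have := yb i; have := svalP (qP i); rewrite /= !mxE -wE !ltr_norml => /andP[? ?] /andP[? ?].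
    by apply/andP; split; lra.
  apply: le_lt_trans (enorm_lt_coord h _) _; first by rewrite mulr_gt0.
  rewrite wE mulrA ltr_pdivrMr//; rewrite ltr_pdivrMr// in kr.
  by have := ler_nat R m m.+1; rewrite leqnSn; lra.
apply: countable_bigcupT_measurable => [|qk]; first exact: countableP.
case: asboolP => // _.
have -> : f @^-1` box qk =
    \bigcap_i [set t | `|(f t : 'rV[R]_m) ord0 i - ratr (qk.1 ord0 i)| < qk.2.+1%:R^-1].
  by apply/seteqP; split => [t h i _|t h i]; [exact: h|exact: (h i)].
rewrite bigcap_mkcond; apply: fin_bigcap_measurable => // i _.
rewrite mem_set//.
apply: measurable_ltr_set => //.
apply: measurableT_comp => //; exact: measurable_funB.
Qed.

End BorelRow.

(* The library does not register [m1 \x m2] as a sigma-finite measure, so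
   sigma-finiteness is proved directly for its image under a bijection. *)
Section ProductImage.
Context d1 d2 d3 (T1 : measurableType d1) (T2 : measurableType d2)
  (T3 : measurableType d3) (R : realType).
Variables (m1 : {sigma_finite_measure set T1 -> \bar R})
  (m2 : {sigma_finite_measure set T2 -> \bar R}).
Variables (f : T1 * T2 -> T3) (g : T3 -> T1 * T2).
Hypotheses (mf : measurable_fun setT f) (mg : measurable_fun setT g).
Hypothesis fK : cancel f g.

Definition product_image_fun := pushforward (m1 \x m2)%E f.
Local Notation nu := product_image_fun.

Let nu0 : nu set0 = 0%E.
Proof. by rewrite /product_image_fun /pushforward preimage_set0 measure0. Qed.

Let nu_ge0 A : (0 <= nu A)%E. Proof. exact: measure_ge0. Qed.

Let nu_sigma_additive : semi_sigma_additive nu.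
Proof.
exact: (@measure_semi_sigma_additive _ _ _
  (measure_function_pushforward__canonical__measure_function_Measure
     (m1 \x m2)%E mf)).
Qed.

HB.instance Definition _ := isMeasure.Build _ _ _ nu nu0 nu_ge0 nu_sigma_additive.

Let nu_sigma_finite : sigma_finite setT nu.
Proof.
have /sigma_finiteP[F [TF ndF Ffin]] := sigma_finiteT m1.
have /sigma_finiteP[G [TG ndG Gfin]] := sigma_finiteT m2.
exists (fun i => g @^-1` (F i `*` G i)).
  apply/seteqP; split => // x _.
  have : setT (g x).1 by []; rewrite TF => -[i _ Fi].
  have : setT (g x).2 by []; rewrite TG => -[j _ Gj].
  exists (maxn i j) => //; split => /=.
    by have /subsetPset := ndF _ _ (leq_maxl i j); exact.
  by have /subsetPset := ndG _ _ (leq_maxr i j); exact.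
move=> i; have [mF Ff] := Ffin i; have [mG Gf] := Gfin i; split.
  by rewrite -(setTI (_ @^-1` _)); apply: mg => //; exact: measurableX.
rewrite /product_image_fun /pushforward.
have -> : f @^-1` (g @^-1` (F i `*` G i)) = F i `*` G i.
  by apply/seteqP; split => x/=; rewrite fK.
by rewrite product_measure1E// lte_mul_pinfty// ge0_fin_numE.
Qed.

HB.instance Definition _ := Measure_isSigmaFinite.Build _ _ _ nu nu_sigma_finite.

Definition product_image : {sigma_finite_measure set T3 -> \bar R} := nu.

End ProductImage.

(** * The measure behind the iterated integral *)

Section RowMeasure.
Variable R : realType.
Local Open Scope ereal_scope.

Definition rowcons m (p : measurableTypeR R * rowspace R m) : rowspace R m.+1 :=
  row_mx (p.1%:M : 'rV[R]_1) (p.2 : 'rV[R]_m).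

Definition rowuncons m (x : rowspace R m.+1) : measurableTypeR R * rowspace R m :=
  ((x : 'rV[R]_m.+1) ord0 ord0, rsubmx (x : 'rV[R]_(1 + m))).

Lemma rowcons0 m p : (@rowcons m p : 'rV[R]_m.+1) ord0 ord0 = p.1.
Proof.
rewrite (_ : ord0 = lshift m (ord0 : 'I_1)); last exact: val_inj.
by apply: (etrans (row_mxEl _ _ _ _)); rewrite mxE eqxx mulr1n.
Qed.

Lemma rowconsS m p (i : 'I_m) :
  (@rowcons m p : 'rV[R]_m.+1) ord0 (lift ord0 i) = (p.2 : 'rV[R]_m) ord0 i.
Proof.
rewrite (_ : lift ord0 i = rshift 1 i); last exact: val_inj.
exact: row_mxEr.
Qed.

Lemma rowconsK m : cancel (@rowcons m) (@rowuncons m).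
Proof.
move=> [t x]; rewrite /rowuncons rowcons0/=; congr pair.
by rewrite /rowcons row_mxKr.
Qed.

Lemma measurable_rowcons m : measurable_fun setT (@rowcons m).
Proof.
apply: measurable_row => i; case: (unliftP ord0 i) => [j|] ->.
  under eq_fun do rewrite rowconsS.
  exact: (measurableT_comp (measurable_coord j) measurable_snd).
under eq_fun do rewrite rowcons0; exact: measurable_fst.
Qed.

Lemma measurable_rowuncons m : measurable_fun setT (@rowuncons m).
Proof.
apply: measurable_fun_pair; first exact: measurable_coord.
apply: measurable_row => i.
rewrite (_ : (fun _ => _) = (fun x : rowspace R m.+1 => (x : 'rV_m.+1) ord0 (rshift 1 i))).
  exact: measurable_coord.
by apply/funext => x; rewrite mxE.
Qed.

(** Recasts [iint] as integration against one sigma-finite measure, so that Tonelli, monotone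
    convergence and null sets apply. The measure is the image under [rowcons] of a product, and
    Tonelli peels off the first coordinate. *)
Lemma row_measure_exists m :
  exists mu : {sigma_finite_measure set (rowspace R m) -> \bar R},
    forall f, measurable_fun setT f -> (forall x, 0 <= f x) ->
      \int[mu]_x f x = iint f.
Proof.
elim: m => [|m [mu muE]].
  exists (dirac ((0 : 'rV[R]_0)%R : rowspace R 0)) => f mf f0.
  by rewrite integral_dirac//= diracE in_setT mul1e.
pose lm : {sigma_finite_measure set (measurableTypeR R) -> \bar R} :=
  @lebesgue_measure R.
exists (product_image lm mu (@measurable_rowcons m)
  (@measurable_rowuncons m) (@rowconsK m)) => f mf f0.
transitivity (\int[pushforward (lm \x mu) (@rowcons m)]_x f x); first by [].
rewrite ge0_integral_pushforward//; last exact: measurable_rowcons.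
rewrite preimage_setT fubini_tonelli1; first last.
- by move=> x; exact: f0.
- exact: (measurableT_comp mf (@measurable_rowcons m)).
rewrite /=; apply: eq_integral => t _; rewrite /fubini_F -muE//.
exact: (measurable_fun_pair2 t (measurableT_comp mf (@measurable_rowcons m))).
Qed.

Definition row_measure m : {sigma_finite_measure set (rowspace R m) -> \bar R} :=
  sval (cid (row_measure_exists m)).

Lemma iintE m (f : rowspace R m -> \bar R) : measurable_fun setT f ->
  (forall x, 0 <= f x) -> iint f = \int[row_measure m]_x f x.
Proof. by move=> mf f0; rewrite -(svalP (cid (row_measure_exists m)) f mf f0). Qed.

Lemma integral_rowS m (f : rowspace R m.+1 -> \bar R) : measurable_fun setT f ->
  (forall x, 0 <= f x) -> \int[row_measure m.+1]_x f x =
  \int[@lebesgue_measure R]_t \int[row_measure m]_x f (rowcons (t, x)).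
Proof.
move=> mf f0; rewrite -iintE//=; apply: eq_integral => t _; rewrite -iintE//.
exact: (measurable_fun_pair2 t (measurableT_comp mf (@measurable_rowcons m))).
Qed.

End RowMeasure.

(** * Reflections, translations, volumes of boxes and slabs *)

Section Invariance.
Variable R : realType.
Local Notation leb := (@lebesgue_measure R).
Local Open Scope ereal_scope.

(** Reflection is taken as the basic symmetry: the comparison of a paraboloid with its mirror image
    needs it, and two reflections compose to a translation. *)
Lemma lebesgue_measure_reflect (a : R) (A : set R) : measurable A ->
  pushforward leb ((fun t => a - t)%R : _ -> measurableTypeR R) A = leb A.
Proof.
have mf : measurable_fun [set: measurableTypeR R]
  ((fun t => a - t)%R : _ -> measurableTypeR R) by exact: measurable_funB.
pose nu := measure_function_pushforward__canonical__measure_function_Measure leb mf.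
move=> mA; apply/esym; apply: (lebesgue_measure_unique (mu := nu)) => //= _ [[x y]] _ <-.
rewrite /pushforward.
have -> : (fun t => a - t)%R @^-1` `]x, y] = `[(a - y)%R, (a - x)%R[%classic.
  by apply/seteqP; split => t/=; rewrite !in_itv/= => /andP[? ?]; apply/andP; split; lra.
rewrite !lebesgue_measure_itv/= !lte_fin ltrD2l ltrN2.
by case: ifPn => // _; rewrite -!EFinB; congr EFin; lra.
Qed.

Lemma integral_lebesgue_indic (A : set R) : measurable A ->
  \int[leb]_t (\1_A t)%:E = leb A.
Proof. by move=> mA; rewrite integral_indic// setIT. Qed.

Lemma lebesgue_integral_reflect (a : R) (f : R -> \bar R) :
  measurable_fun setT f -> (forall t, 0 <= f t) ->
  \int[leb]_t f (a - t)%R = \int[leb]_t f t.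
Proof.
move=> mf f0.
have mr : measurable_fun [set: measurableTypeR R]
  ((fun t => a - t)%R : _ -> measurableTypeR R) by exact: measurable_funB.
have := ge0_integral_pushforward mr leb measurableT mf (in1W f0).
rewrite preimage_setT => <-.
by apply: eq_measure_integral => A mA _; apply: lebesgue_measure_reflect.
Qed.

Lemma integral_row_indic m (A : set (rowspace R m)) : measurable A ->
  \int[row_measure R m]_x (\1_A x)%:E = row_measure R m A.
Proof. by move=> mA; rewrite integral_indic// setIT. Qed.

Lemma integral_row0 (f : rowspace R 0 -> \bar R) : measurable_fun setT f ->
  (forall x, 0 <= f x) -> \int[row_measure R 0]_x f x = f (0%R : 'rV[R]_0).
Proof. by move=> mf f0; rewrite -iintE. Qed.

Lemma measurable_row_integral m (f : rowspace R m.+1 -> \bar R) :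
  measurable_fun setT f -> (forall x, 0 <= f x) ->
  measurable_fun [set: measurableTypeR R]
    (fun t => \int[row_measure R m]_x f (rowcons (t, x))).
Proof.
move=> mf f0.
apply: (@measurable_fun_fubini_tonelli_F _ _ _ _ _ (row_measure R m) (f \o @rowcons R m)).
- exact: (measurableT_comp mf (@measurable_rowcons R m)).
- by move=> x; exact: f0.
Qed.

Lemma integral_rowS_swap m (f : rowspace R m.+1 -> \bar R) :
  measurable_fun setT f -> (forall x, 0 <= f x) ->
  \int[row_measure R m.+1]_x f x =
  \int[row_measure R m]_x \int[leb]_t f (rowcons (t, x)).
Proof.
move=> mf f0; rewrite integral_rowS//.
apply: (@fubini_tonelli _ _ _ _ _ leb (row_measure R m) (f \o @rowcons R m)).
- exact: (measurableT_comp mf (@measurable_rowcons R m)).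
- by move=> x; exact: f0.
Qed.

Lemma measurable_row_sub m (a : 'rV[R]_m) :
  measurable_fun setT ((fun y : 'rV[R]_m => (a - y)%R) : rowspace R m -> rowspace R m).
Proof.
apply: measurable_row => i.
rewrite (_ : (fun _ => _) = (fun y : rowspace R m => (a ord0 i - (y : 'rV[R]_m) ord0 i)%R)).
  by apply: measurable_funB => //; exact: measurable_coord.
by apply/funext => y; rewrite !mxE.
Qed.

Lemma measurable_row_translate m (u : 'rV[R]_m) :
  measurable_fun setT ((fun y : 'rV[R]_m => (y - u)%R) : rowspace R m -> rowspace R m).
Proof.
rewrite (_ : (fun _ => _) = fun y : 'rV[R]_m => (0 - (u - y))%R).
  exact: (measurableT_comp (measurable_row_sub 0%R) (measurable_row_sub u)).
by apply/funext => y/=; rewrite sub0r opprB.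
Qed.

Lemma integral_row_reflect m (a : 'rV[R]_m) (f : rowspace R m -> \bar R) :
  measurable_fun setT f -> (forall x, 0 <= f x) ->
  \int[row_measure R m]_y f (a - (y : 'rV[R]_m))%R = \int[row_measure R m]_y f y.
Proof.
elim: m a f => [|m IH] a f mf f0.
  rewrite !integral_row0//; last exact: (measurableT_comp mf (measurable_row_sub a)).
  by congr f; apply/rowP => -[].
rewrite integral_rowS//; last exact: (measurableT_comp mf (measurable_row_sub a)).
pose a0 := a ord0 ord0; pose a' : 'rV[R]_m := \row_i a ord0 (lift ord0 i).
have aE t x : (a - rowcons (t, x))%R = rowcons ((a0 - t)%R, (a' - (x : 'rV[R]_m))%R) :> 'rV[R]_m.+1.
  apply/rowP => i.
  transitivity (a ord0 i - (rowcons (t, x) : 'rV[R]_m.+1) ord0 i)%R; first by rewrite !mxE.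
  case: (unliftP ord0 i) => [j|] ->; last by rewrite !rowcons0.
  by rewrite !rowconsS /= !mxE.
transitivity (\int[leb]_t \int[row_measure R m]_x f (rowcons ((a0 - t)%R, x))).
  apply: eq_integral => t _; under eq_integral do rewrite aE.
  apply: (IH a' (fun x => f (rowcons ((a0 - t)%R, x)))) => //.
  exact: (measurable_fun_pair2 (a0 - t)%R (measurableT_comp mf (@measurable_rowcons R m))).
rewrite (lebesgue_integral_reflect a0
  (f := fun t => \int[row_measure R m]_x f (rowcons (t, x)))).
- by rewrite integral_rowS.
- exact: measurable_row_integral.
- by move=> t; apply: integral_ge0.
Qed.

Lemma integral_row_shift m (a : 'rV[R]_m) (f : rowspace R m -> \bar R) :
  measurable_fun setT f -> (forall x, 0 <= f x) ->
  \int[row_measure R m]_y f ((y : 'rV[R]_m) - a)%R = \int[row_measure R m]_y f y.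
Proof.
move=> mf f0; rewrite -(integral_row_reflect a)//; last first.
  exact: (measurableT_comp mf (measurable_row_translate a)).
rewrite -[RHS](integral_row_reflect (0%R : 'rV[R]_m))//.
by apply: eq_integral => y _; rewrite sub0r addrAC subrr sub0r.
Qed.


Lemma measurable_row_section m (S : set (rowspace R m.+1)) t : measurable S ->
  measurable [set x : rowspace R m | S (rowcons (t, x))].
Proof.
move=> mS; have := measurable_fun_pair2 (t : measurableTypeR R) (@measurable_rowcons R m).
by move=> /(_ measurableT S mS); rewrite setTI.
Qed.

Lemma measurable_row_section0 m (S : set (rowspace R m.+1)) x : measurable S ->
  measurable [set t : measurableTypeR R | S (rowcons (t, x))].
Proof.
move=> mS; have := measurable_fun_pair1 x (@measurable_rowcons R m).
by move=> /(_ measurableT S mS); rewrite setTI.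
Qed.

Lemma row_measureS m (S : set (rowspace R m.+1)) : measurable S ->
  row_measure R m.+1 S =
  \int[leb]_t row_measure R m [set x | S (rowcons (t, x))].
Proof.
move=> mS; transitivity (\int[row_measure R m.+1]_x (\1_S x)%:E).
  by rewrite integral_indic// setIT.
rewrite integral_rowS//; last exact/measurable_EFinP.
apply: eq_integral => t _; have mSt := measurable_row_section t mS.
by rewrite -[in RHS](setIT [set x | _]) -integral_indic.
Qed.

Lemma row_measureS_swap m (S : set (rowspace R m.+1)) : measurable S ->
  row_measure R m.+1 S =
  \int[row_measure R m]_x leb [set t | S (rowcons (t, x))].
Proof.
move=> mS; transitivity (\int[row_measure R m.+1]_x (\1_S x)%:E).
  by rewrite integral_indic// setIT.
rewrite integral_rowS_swap//; last exact/measurable_EFinP.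
apply: eq_integral => x _; have mSt := measurable_row_section0 x mS.
by rewrite -[in RHS](setIT [set t | _]) -integral_indic.
Qed.

Lemma measurable_open_box m (a b : 'I_m -> R) :
  measurable [set x : rowspace R m | forall i, (a i < (x : 'rV[R]_m) ord0 i < b i)%R].
Proof.
rewrite (_ : [set _ | _] = \bigcap_(i in [set: 'I_m])
    ([set x : rowspace R m | (a i < (x : 'rV[R]_m) ord0 i)%R] `&`
     [set x : rowspace R m | ((x : 'rV[R]_m) ord0 i < b i)%R])).
  apply: fin_bigcap_measurable => // i _; apply: measurableI;
  by apply: measurable_ltr_set => //; exact: measurable_coord.
apply/seteqP; split => x /= h i; first by move=> _; have /andP[] := h i.
by have [-> ->] := h i I.
Qed.

Lemma row_measure_box m (a b : 'I_m -> R) : (forall i, a i <= b i)%R ->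
  row_measure R m [set x | forall i, (a i < (x : 'rV[R]_m) ord0 i < b i)%R] =
  (\prod_(i < m) (b i - a i))%:E.
Proof.
elim: m a b => [|m IH] a b ab.
  rewrite big_ord0 (_ : [set _ | _] = setT); last first.
    by apply/seteqP; split => // x _ [].
  have <- : \int[row_measure R 0]_x (\1_setT x)%:E = 1.
    by rewrite integral_row0//; [rewrite indicT|exact/measurable_EFinP].
  by rewrite integral_indic// setIT.
rewrite row_measureS; last exact: measurable_open_box.
set p := (\prod_(i < m) (b (lift ord0 i) - a (lift ord0 i)))%R.
transitivity (\int[leb]_t (p%:E * (\1_(`]a ord0, b ord0[%classic) t)%:E)).
  apply: eq_integral => t _; rewrite indicE.
  have [tab|tab] := boolP (t \in `]a ord0, b ord0[%classic).
    rewrite mule1 -(IH _ _ (fun i => ab (lift ord0 i))).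
    congr (row_measure R m _); apply/seteqP; split => x /= h i.
      by have := h (lift ord0 i); rewrite rowconsS.
    case: (unliftP ord0 i) => [j|] ->; first by rewrite rowconsS; exact: h.
    by rewrite rowcons0; rewrite inE/= in_itv/= in tab.
  rewrite mule0 (_ : [set x | _] = set0) ?measure0//.
  apply/seteqP; split => // x /= /(_ ord0); rewrite rowcons0 => h.
  by move/negP : tab; apply; rewrite inE/= in_itv/=.
rewrite ge0_integralZl//=; first last.
- by rewrite lee_fin; apply: prodr_ge0 => i _; rewrite subr_ge0.
- exact/measurable_EFinP.
rewrite integral_lebesgue_indic// lebesgue_measure_itv/= lte_fin big_ord_recl -/p.
case: ifPn => [_|]; first by rewrite -EFinD -EFinM mulrC.
rewrite -leNgt => h; have -> : (b ord0 - a ord0)%R = 0%R.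
  by have := ab ord0; lra.
by rewrite mul0r mule0.
Qed.

Lemma measurable_linear_form m (a : 'I_m -> R) :
  measurable_fun [set: rowspace R m]
    (fun x : 'rV[R]_m => \sum_(i < m) a i * x ord0 i)%R.
Proof.
apply: measurable_sum => i; apply: measurable_funM => //; exact: measurable_coord.
Qed.

Lemma measurable_slab m (a : 'I_m -> R) (e r w : R) :
  measurable [set x : rowspace R m | (forall i, - r < (x : 'rV[R]_m) ord0 i < r)%R /\
    (`|\sum_(i < m) a i * (x : 'rV[R]_m) ord0 i + e| < w)%R].
Proof.
apply: measurableI; first exact: measurable_open_box.
apply: measurable_ltr_set => //; apply: measurableT_comp => //.
by apply: measurable_funD => //; exact: measurable_linear_form.
Qed.


Lemma measurable_fun_row_section m (S : set (rowspace R m.+1)) : measurable S ->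
  measurable_fun [set: measurableTypeR R]
    (fun t => row_measure R m [set x | S (rowcons (t, x))]).
Proof.
move=> mS; rewrite (_ : (fun _ => _) = row_measure R m \o xsection (@rowcons R m @^-1` S)).
  apply: measurable_fun_xsection; rewrite -[X in measurable X]setTI.
  exact: measurable_rowcons.
by apply/funext => t /=; rewrite xsectionE.
Qed.

Lemma measurable_fun_row_section0 m (S : set (rowspace R m.+1)) : measurable S ->
  measurable_fun [set: rowspace R m]
    (fun x => leb [set t | S (rowcons (t, x))]).
Proof.
move=> mS; rewrite (_ : (fun _ => _) = leb \o ysection (@rowcons R m @^-1` S)).
  apply: measurable_fun_ysection; rewrite -[X in measurable X]setTI.
  exact: measurable_rowcons.
by apply/funext => t /=; rewrite ysectionE.
Qed.

Lemma lebesgue_measure_slab (a c w : R) : (1 <= a)%R -> (0 <= w)%R ->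
  leb [set t | (`|a * t + c| < w)%R] <= (2 * w)%:E.
Proof.
move=> a1 w0; have a0 : (0 < a)%R by lra.
rewrite (_ : [set t | _] = `]((- w - c) / a)%R, ((w - c) / a)%R[%classic); last first.
  apply/seteqP; split => t /=; rewrite in_itv/= ltr_norml ltr_pdivrMr// ltr_pdivlMr//;
    rewrite (mulrC t a) => /andP[? ?]; apply/andP; split; lra.
rewrite lebesgue_measure_itv/= lte_fin; case: ifPn => _; last by rewrite lee_fin; lra.
rewrite -EFinD lee_fin -mulrBl ler_pdivrMr//.
have -> : (w - c - (- w - c) = 2 * w)%R by ring.
by rewrite ler_peMr//; lra.
Qed.


Lemma row_measure_cube m (r : R) : (0 <= r)%R ->
  row_measure R m [set x | forall i, (- r < (x : 'rV[R]_m) ord0 i < r)%R] =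
    ((2 * r) ^+ m)%:E.
Proof.
move=> r0.
rewrite (@row_measure_box m (fun=> - r)%R (fun=> r)); last by move=> _; lra.
by rewrite prodr_const card_ord; congr ((_ ^+ _)%:E); ring.
Qed.

(** With the other coordinates fixed, the slab condition confines coordinate [0] to an interval of
    length at most [2 * w], because its coefficient is at least [1]; the other coordinates range
    over a cube. *)
Lemma row_measure_slab0 m (a : 'I_m.+1 -> R) (e r w : R) :
  (1 <= a ord0)%R -> (0 <= r)%R -> (0 <= w)%R ->
  row_measure R m.+1
    [set x | (forall i, - r < (x : 'rV[R]_m.+1) ord0 i < r)%R /\
      (`|\sum_(i < m.+1) a i * (x : 'rV[R]_m.+1) ord0 i + e| < w)%R] <=
  ((2 * r) ^+ m * (2 * w))%:E.
Proof.
move=> a1 r0 w0; set S := [set x | _].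
have mS : measurable (S : set (rowspace R _)) by exact: measurable_slab.
have mB := @measurable_open_box m (fun=> - r)%R (fun=> r).
rewrite row_measureS_swap//; set B := (X in measurable X) in mB.
apply: (@le_trans _ _ (\int[row_measure R m]_x ((2 * w)%:E * (\1_B x)%:E))).
  apply: ge0_le_integral => //.
  - exact: measurable_fun_row_section0.
  - by apply: measurable_funeM; exact/measurable_EFinP.
  move=> x _; rewrite indicE; have [xB|xB] := boolP (x \in B).
    rewrite mule1.
    pose c := (\sum_(i < m) a (lift ord0 i) * (x : 'rV[R]_m) ord0 i + e)%R.
    apply: le_trans (lebesgue_measure_slab c a1 w0); apply: le_measure.
    - by rewrite inE; exact: measurable_row_section0.
    - rewrite inE; apply: measurable_ltr_set => //; apply: measurableT_comp => //.
      by apply: measurable_funD => //; apply: measurable_funM.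
    move=> t [_] /=; rewrite big_ord_recl rowcons0 /=.
    by under eq_bigr do rewrite rowconsS; rewrite addrA.
  rewrite (_ : [set t | _] = set0) ?measure0 ?mule_ge0 ?lee_fin ?mulr_ge0//.
  apply/seteqP; split => // t [h _]; move/negP : xB; apply; rewrite inE => i /=.
  by have := h (lift ord0 i); rewrite rowconsS.
rewrite ge0_integralZl//=; first last.
- by rewrite lee_fin mulr_ge0.
- exact/measurable_EFinP.
by rewrite integral_row_indic// row_measure_cube// -EFinM mulrC.
Qed.

Lemma row_measure_slab m (a : 'I_m.+1 -> R) j (e r w : R) :
  (1 <= a j)%R -> (0 <= r)%R -> (0 <= w)%R ->
  row_measure R m.+1
    [set x | (forall i, - r < (x : 'rV[R]_m.+1) ord0 i < r)%R /\
      (`|\sum_(i < m.+1) a i * (x : 'rV[R]_m.+1) ord0 i + e| < w)%R] <=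
  ((2 * r) ^+ m * (2 * w))%:E.
Proof.
move=> + r0 w0; elim: m a j e => [|m IH] a j e.
  by rewrite (ord1 j) => a1; exact: row_measure_slab0.
case: (unliftP ord0 j) => [j'|] -> a1; last exact: row_measure_slab0.
set S := [set x | _].
have mS : measurable (S : set (rowspace R _)) by exact: measurable_slab.
rewrite row_measureS//.
set C := ((2 * r) ^+ m * (2 * w))%R.
apply: (@le_trans _ _ (\int[leb]_t (C%:E * (\1_(`](- r)%R, r%R[%classic) t)%:E))).
  apply: ge0_le_integral => //.
  - exact: measurable_fun_row_section.
  - by apply: measurable_funeM; exact/measurable_EFinP.
  move=> t _; rewrite indicE; have [tr|tr] := boolP (t \in `](- r)%R, r%R[%classic).
    rewrite mule1; apply: le_trans (IH (a \o lift ord0) j' (a ord0 * (t : R) + e)%R a1).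
    apply: le_measure; rewrite ?inE.
    - exact: measurable_row_section.
    - exact: measurable_slab.
    move=> x [h] /=; rewrite big_ord_recl rowcons0 /= => h2; split.
      by move=> i; have := h (lift ord0 i); rewrite rowconsS.
    move: h2; under eq_bigr do rewrite rowconsS.
    by rewrite -addrA addrCA.
  rewrite (_ : [set x | _] = set0) ?measure0 ?mule_ge0 ?lee_fin//.
    by rewrite !mulr_ge0 ?exprn_ge0 ?mulr_ge0.
  apply/seteqP; split => // x [/(_ ord0)]; rewrite rowcons0 => h _.
  by move/negP : tr; apply; rewrite inE/= in_itv.
rewrite ge0_integralZl//=; first last.
- by rewrite lee_fin !mulr_ge0 ?exprn_ge0 ?mulr_ge0.
- exact/measurable_EFinP.
rewrite integral_lebesgue_indic// lebesgue_measure_itv/= lte_fin /C exprS.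
case: ifPn => _; first by rewrite -EFinD -EFinM lee_fin le_eqVlt; apply/orP; left; apply/eqP; ring.
by rewrite mule0 lee_fin !mulr_ge0 ?exprn_ge0 ?mulr_ge0.
Qed.

End Invariance.

(** * Kernel estimates *)

Section KernelBounds.
Variable R : realType.

Lemma measurable_enorm m : measurable_fun [set: rowspace R m] (@enorm R m).
Proof.
rewrite (_ : @enorm R m = fun x => (\sum_(i < m) x ord0 i ^+ 2) `^ 2^-1).
  apply: (measurableT_comp (measurable_powR 2^-1)); apply: measurable_sum => i.
  by apply: measurable_funX; exact: measurable_coord.
by apply/funext => x; rewrite powR12_sqrt// sumr_ge0// => i _; exact: sqr_ge0.
Qed.

Lemma measurable_sub_pair m :
  measurable_fun [set: (rowspace R m * rowspace R m)%type]
    ((fun z => (z.1 : 'rV[R]_m) - (z.2 : 'rV[R]_m)) : _ -> rowspace R m).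
Proof.
apply: measurable_row => i.
rewrite (_ : (fun _ => _) = fun z : rowspace R m * rowspace R m =>
  (z.1 : 'rV[R]_m) ord0 i - (z.2 : 'rV[R]_m) ord0 i).
  apply: measurable_funB.
  - exact: (measurableT_comp (measurable_coord i) measurable_fst).
  - exact: (measurableT_comp (measurable_coord i) measurable_snd).
by apply/funext => y; rewrite !mxE.
Qed.

Lemma geometric_sum_le (q : R) n : 0 <= q < 1 -> \sum_(k < n) q ^+ k <= (1 - q)^-1.
Proof.
move=> /andP[q0 q1]; have h : 0 < 1 - q by lra.
rewrite -[_^-1]mul1r ler_pdivlMr// mulrC -[1 - q]opprB mulNr -subrX1 opprB.
by have := exprn_ge0 n q0; lra.
Qed.

Lemma geometric_nneseries_le (c q : R) : 0 <= c -> 0 <= q < 1 ->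
  (\sum_(0 <= k <oo) (c * q ^+ k)%:E <= (c / (1 - q))%:E)%E.
Proof.
move=> c0 q01; have q0 : 0 <= q by case/andP: q01.
apply: lime_le.
  by apply: is_cvg_nneseries => n _ _; rewrite lee_fin mulr_ge0// exprn_ge0.
apply: nearW => n; rewrite big_mkord sumEFin lee_fin -mulr_sumr.
by rewrite ler_wpM2l// geometric_sum_le.
Qed.

Lemma powR_mul_expn (x q p : R) : 0 <= x -> 0 <= q -> forall k, (x * q ^+ k) `^ p = x `^ p * (q `^ p) ^+ k.
Proof.
move=> x0 q0 k; rewrite powRM ?exprn_ge0//; congr (_ * _).
by rewrite -!powR_mulrn ?powR_ge0// -!powRrM mulrC.
Qed.

Local Notation mu := (row_measure R).
Local Open Scope ereal_scope.

Lemma measurable_eball0 m (r : R) : measurable [set z : rowspace R m | (enorm z < r)%R].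
Proof. by apply: measurable_ltr_set => //; exact: measurable_enorm. Qed.

Lemma measurable_enorm_powR m (p : R) :
  measurable_fun [set: rowspace R m] (fun z : 'rV[R]_m => ((enorm z) `^ p)%:E).
Proof.
apply/measurable_EFinP.
exact: (measurableT_comp (measurable_powR p) (@measurable_enorm m)).
Qed.

(* Geometric shells of radii [r0 * b ^ k]: with [b > 1] they exhaust a
   neighbourhood of infinity, with [b < 1] a neighbourhood of the origin. *)
Lemma kernel_shells_le m (s sigma r0 b C : R) (S : set (rowspace R m)) :
  measurable S -> (0 < r0)%R -> (0 < b)%R -> (0 <= C)%R -> (0 < s)%R ->
  (b `^ (sigma - s) < 1)%R ->
  (forall k, mu m (S `&` [set z | (enorm z < r0 * b ^+ k)%R]) <=
     (C * (r0 * b ^+ k) `^ (m%:R + sigma))%:E) ->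
  (forall z, S z -> z = (0%R : 'rV[R]_m) \/
     exists k, ((r0 * b ^+ k) / 2 <= enorm z < r0 * b ^+ k)%R) ->
  \int[mu m]_(z in S) ((enorm (z : 'rV[R]_m)) `^ (- (m%:R + s)))%:E <=
  (2 `^ (m%:R + s) * C * r0 `^ (sigma - s) / (1 - b `^ (sigma - s)))%:E.
Proof.
move=> mS r00 b0 C0 s0 q1 vol cov.
pose r k := (r0 * b ^+ k)%R.
have rk k : (0 < r k)%R by rewrite mulr_gt0// exprn_gt0.
pose p := (m%:R + s)%R.
have p0 : (0 < p)%R by rewrite ltr_wpDl.
pose Bk k := [set z : rowspace R m | (enorm z < r k)%R].
have mB k : measurable (Bk k) by exact: measurable_eball0.
pose f k (z : rowspace R m) := ((r k / 2) `^ (- p))%:E * (\1_(Bk k) z)%:E.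
have f0 k z : 0 <= f k z by rewrite mule_ge0 ?lee_fin ?powR_ge0.
have mf k : measurable_fun S (f k).
  by apply: measurable_funeM; apply/measurable_EFinP.
apply: (@le_trans _ _ (\int[mu m]_(z in S) \sum_(0 <= k <oo) f k z)).
  apply: ge0_le_integral => //.
  - by move=> z _; rewrite lee_fin powR_ge0.
  - by apply: measurable_funTS; exact: measurable_enorm_powR.
  - by apply: ge0_emeasurable_sum => // k z Sz _.
  (* At the origin the kernel takes the default value [0] of [powR], not infinity. Elsewhere the
     term of the shell containing [z] alone dominates the kernel. *)
  move=> z /cov[->|[k /andP[k1 k2]]].
    rewrite enorm0 powR0 ?oppr_eq0 ?gt_eqF//; exact: nneseries_ge0.
  apply: le_trans (nneseries_lim_ge k.+1 _) => //.
  rewrite big_nat_recr//= -[X in X <= _]add0e; apply: leeD.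
    exact: sume_ge0.
  rewrite /f indicE mem_set// mule1 lee_fin !powRN lef_pV2 ?posrE ?powR_gt0 ?divr_gt0//.
    by apply: ge0_ler_powR => //; rewrite ?nnegrE ?enorm_ge0//; apply: ltW => //; rewrite divr_gt0.
  by apply: lt_le_trans k1; apply: (divr_gt0 (rk k)).
rewrite integral_nneseries//.
have q0 : (0 <= b `^ (sigma - s))%R by rewrite powR_ge0.
apply: le_trans (geometric_nneseries_le _ _); last 2 first.
- by rewrite !mulr_ge0 ?powR_ge0.
- by rewrite q0.
apply: lee_nneseries => [k _ _|k _]; first by apply: integral_ge0.
rewrite /f ge0_integralZl ?lee_fin ?powR_ge0//; last first.
  exact/measurable_EFinP.
rewrite integral_indic// setIC.
(* Kernel size times volume on shell [k] is a constant times [r k] to the power [sigma - s], hence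
   geometric with ratio [b] to that power. *)
apply: (@le_trans _ _ (((r k / 2) `^ (- p))%:E * (C * r k `^ (m%:R + sigma))%:E)).
  by apply: lee_wpmul2l (vol k); rewrite lee_fin powR_ge0.
rewrite -EFinM lee_fin le_eqVlt; apply/orP; left; apply/eqP.
rewrite -[RHS]mulrA -[in RHS]powR_mul_expn ?ltW// -/(r k).
have -> : ((r k / 2) `^ (- p) = 2 `^ p * r k `^ (- p))%R.
  by rewrite powRM ?ltW// -powR_inv1// -powRrM mulN1r opprK mulrC.
have -> : (r k `^ (sigma - s) = r k `^ (- p) * r k `^ (m%:R + sigma))%R.
  rewrite -powRD; first by congr (_ `^ _)%R; rewrite /p; ring.
  by apply/implyP => _; rewrite gt_eqF.
by rewrite -/p; ring.
Qed.

End KernelBounds.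

Lemma ge0_integral_setU_le d (T : measurableType d) (R : realType)
    (mu : {measure set T -> \bar R}) (A B : set T) (f : T -> \bar R) :
  measurable A -> measurable B -> measurable_fun setT f -> (forall x, 0 <= f x)%E ->
  (\int[mu]_(x in A `|` B) f x <= \int[mu]_(x in A) f x + \int[mu]_(x in B) f x)%E.
Proof.
move=> mA mB mf f0; have -> : A `|` B = A `|` (B `\` A).
  apply/seteqP; split => x [Ax|Bx]; try by left.
    by have [Ax|nAx] := pselect (A x); [left|right].
  by right; case: Bx.
rewrite ge0_integral_setU//.
- apply: leeD => //; apply: ge0_subset_integral => //; first exact: measurableD.
  exact: measurable_funTS.
- exact: measurableD.
- exact: measurable_funTS.
- by rewrite disj_set2E setDIK.
Qed.

(** * Kernel mass far from the origin and in thin slabs *)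

Section Balance.
Variable R : realType.
Local Notation mu := (row_measure R).

Lemma enorm_eq0 m (z : 'rV[R]_m) : enorm z = 0 -> z = 0.
Proof.
move=> z0; apply/rowP => i; rewrite mxE; apply/normr0_eq0/le_anti.
by rewrite normr_ge0 -z0 coord_enorm.
Qed.

Lemma pow2_unbounded (x : R) : exists k, x < 2 ^+ k.
Proof.
exists (Num.truncn x).+1; apply: lt_trans (truncnS_gt x) _.
by rewrite -natrX ltr_nat ltn_expl.
Qed.

Lemma dyadic_above (a x : R) : 0 < a -> a <= x ->
  exists k, (2 * a * 2 ^+ k) / 2 <= x < 2 * a * 2 ^+ k.
Proof.
move=> a0 ax; have ex : exists k, x < 2 * a * 2 ^+ k.
  have [k xk] := pow2_unbounded (x / (2 * a)); exists k.
  by rewrite ltr_pdivrMr ?mulr_gt0// in xk; rewrite mulrC.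
case: (ex_minnP ex) => k xk kmin; exists k; rewrite xk andbT.
case: k xk kmin => [|k] xk kmin; first by rewrite expr0; lra.
rewrite leNgt; apply/negP => h; suff : (k.+1 <= k)%N by rewrite ltnn.
by apply: kmin; move: h; rewrite exprS; lra.
Qed.

Lemma dyadic_below (x : R) : 0 < x -> x < 1 ->
  exists k, (1 * 2^-1 ^+ k) / 2 <= x < 1 * 2^-1 ^+ k.
Proof.
move=> x0 x1; have ex : exists k, (2^-1 ^+ k) / 2 <= x.
  have [k xk] := pow2_unbounded x^-1; exists k.
  rewrite exprVn -invfM -[x]invrK lef_pV2 ?posrE ?mulr_gt0 ?exprn_gt0 ?invr_gt0//.
  have := exprn_gt0 k (ltr0Sn R 1); lra.
case: (ex_minnP ex) => k xk kmin; exists k; rewrite !mul1r xk /=.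
case: k xk kmin => [|k] xk kmin; first by rewrite expr0.
rewrite ltNge; apply/negP => h; suff : (k.+1 <= k)%N by rewrite ltnn.
by apply: kmin; move: h; rewrite exprS; lra.
Qed.

Lemma eball_cube_measure m (S : set (rowspace R m)) (r : R) : measurable S -> 0 <= r ->
  (mu m (S `&` [set z | enorm z < r]%R) <= ((2 * r) ^+ m)%:E)%E.
Proof.
move=> mS r0; rewrite -row_measure_cube//; apply: le_measure; rewrite ?inE.
- by apply: measurableI => //; exact: measurable_eball0.
- exact: measurable_open_box.
move=> z [_ /= zr] i; rewrite -ltr_norml; exact: le_lt_trans (coord_enorm z i) zr.
Qed.

Local Open Scope ereal_scope.

Lemma measurable_far m (rho : R) :
  measurable [set z : rowspace R m | (rho <= enorm (z : 'rV[R]_m))%R].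
Proof.
rewrite (_ : [set _ | _] = ~` [set z | (enorm z < rho)%R]).
  by apply: measurableC; exact: measurable_eball0.
by apply/seteqP; split => z /=; rewrite leNgt => /negP.
Qed.

Lemma measurable_thin_slab m (a : 'I_m -> R) :
  measurable ([set z : rowspace R m | (enorm (z : 'rV[R]_m) < 1)%R] `&`
    [set z | (`|\sum_(i < m) a i * (z : 'rV[R]_m) ord0 i| <=
      enorm (z : 'rV[R]_m) ^+ 2)%R]).
Proof.
apply: measurableI; first exact: measurable_eball0.
rewrite (_ : [set _ | _] = ~` [set z : rowspace R m |
  (enorm (z : 'rV[R]_m) ^+ 2 < `|\sum_(i < m) a i * (z : 'rV[R]_m) ord0 i|)%R]).
  apply: measurableC; apply: measurable_ltr_set.
    by apply: measurable_funX; exact: measurable_enorm.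
  by apply: measurableT_comp => //; exact: measurable_linear_form.
by apply/seteqP; split => z /=; rewrite leNgt => /negP.
Qed.

(** The volume bound by a power [m] of the radius is the case [sigma = 0]; on growing shells the
    ratio [2] to the power [- s] is below [1]. *)
Lemma kernel_far_le m (s rho : R) : (0 < s)%R -> (0 < rho)%R ->
  exists2 L : R, (0 <= L)%R &
  \int[mu m]_(z in [set z | (rho <= enorm (z : 'rV[R]_m))%R])
     ((enorm (z : 'rV[R]_m)) `^ (- (m%:R + s)))%:E <= L%:E.
Proof.
move=> s0 rho0.
have q1 : (2 `^ (0 - s) < 1 :> R)%R.
  rewrite sub0r powRN invf_lt1 ?powR_gt0//.
  have := @gt0_ltr_powR R s s0 1%R 2%R; rewrite !nnegrE powR1; apply => //; lra.
have C0 : (0 <= 2 ^+ m :> R)%R by rewrite exprn_ge0.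
have mS := @measurable_far m rho.
eexists; last first.
  apply: (kernel_shells_le (sigma := 0) (r0 := 2 * rho) (b := 2) mS _ _ C0 s0 q1) => //.
  - by rewrite mulr_gt0.
  - move=> k; have r0 : (0 <= 2 * rho * 2 ^+ k)%R by rewrite !mulr_ge0 ?exprn_ge0// ltW.
    by rewrite addr0 powR_mulrn// -exprMn; exact: eball_cube_measure.
  - by move=> z /= h; right; exact: dyadic_above.
by rewrite !mulr_ge0 ?powR_ge0// invr_ge0; lra.
Qed.

(** Within radius [r] the slab has thickness of order [r ^+ 2], one power better than the ball. This
    is [sigma = 1], summable on shrinking shells because [s < 1]. The bound is uniform in [a], so
    one constant serves all leaves and all their points. *)
Lemma kernel_slab_le m (s : R) : (0 < s < 1)%R ->
  exists2 L : R, (0 <= L)%R & forall (a : 'I_m.+1 -> R) j, (1 <= a j)%R ->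
  \int[mu m.+1]_(z in [set z | (enorm (z : 'rV[R]_m.+1) < 1)%R] `&`
      [set z | (`|\sum_(i < m.+1) a i * (z : 'rV[R]_m.+1) ord0 i| <=
        enorm (z : 'rV[R]_m.+1) ^+ 2)%R])
     ((enorm (z : 'rV[R]_m.+1)) `^ (- (m.+1%:R + s)))%:E <= L%:E.
Proof.
move=> /andP[s0 s1].
have q1 : (2^-1 `^ (1 - s) < 1 :> R)%R.
  have s1' : (0 < 1 - s)%R by lra.
  have := @gt0_ltr_powR R (1 - s) s1' 2^-1%R 1%R; rewrite !nnegrE powR1.
  by apply => //; rewrite invf_lt1// ltr1n.
have C0 : (0 <= 2 ^+ m.+1 :> R)%R by rewrite exprn_ge0.
have rpow (r : R) : (0 <= r)%R ->
    (2 ^+ m.+1 * r `^ (m.+1%:R + 1) = (2 * r) ^+ m * (2 * r ^+ 2))%R.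
  by move=> r0; rewrite natr1 powR_mulrn// exprMn !exprS; ring.
eexists; last first.
  move=> a j aj.
  have mS := measurable_thin_slab a.
  apply: (kernel_shells_le (sigma := 1) (r0 := 1) (b := 2^-1) mS _ _ C0 s0 q1) => //.
  - move=> k; set r := (1 * 2^-1 ^+ k)%R.
    have r0 : (0 < r)%R by rewrite /r mul1r exprn_gt0.
    have -> : (2 ^+ m.+1 * r `^ (m.+1%:R + 1) = (2 * r) ^+ m * (2 * r ^+ 2))%R.
      by rewrite -rpow // ltW.
    apply: le_trans (@row_measure_slab R m a j 0 r (r ^+ 2) aj (ltW r0) _); last first.
      by rewrite sqr_ge0.
    apply: le_measure; rewrite ?inE.
    + by apply: measurableI => //; exact: measurable_eball0.
    + exact: measurable_slab.
    move=> z [[_ /= h1] h2]; split.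
      move=> i; rewrite -ltr_norml; exact: le_lt_trans (coord_enorm z i) h2.
    rewrite addr0; apply: le_lt_trans h1 _.
    by rewrite ltrXn2r ?nnegrE ?enorm_ge0// ltW.
  - move=> z [/= h _]; have [/enorm_eq0 ->|z0] := eqVneq (enorm z) 0%R; first by left.
    by right; apply: dyadic_below => //; rewrite lt_def z0 enorm_ge0.
by rewrite !mulr_ge0 ?powR_ge0// invr_ge0; lra.
Qed.

End Balance.

(** * Bounded curvature loss of a paraboloid *)

Section Barrier.
Variable R : realType.
Local Notation mu := (row_measure R).

Definition riesz m (s : R) (z : 'rV[R]_m) : R := enorm z `^ (- (m%:R + s)).

(** The sublevel set of [z j + |z|^2] seen from one of the points of its leaf; [a] is the gradient
    of that function at the point. *)
Definition paraboloid m (a : 'I_m -> R) (rho : R) : set 'rV[R]_m :=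
  [set z | enorm z < rho /\ \sum_(i < m) a i * z ord0 i + enorm z ^+ 2 < 0].

Local Open Scope ereal_scope.

Lemma measurable_paraboloid m (a : 'I_m -> R) (rho : R) :
  measurable (paraboloid a rho : set (rowspace R m)).
Proof.
apply: measurableI; first exact: measurable_eball0.
apply: measurable_ltr_set => //; apply: measurable_funD.
  exact: measurable_linear_form.
by apply: measurable_funX; exact: measurable_enorm.
Qed.

Lemma integral_row_translate m (x : 'rV[R]_m) (S : set (rowspace R m)) (k : 'rV[R]_m -> \bar R) :
  measurable S -> measurable_fun [set: rowspace R m] k -> (forall z, 0 <= k z) ->
  \int[mu m]_(y in [set y | S ((y : 'rV[R]_m) - x)%R]) k ((y : 'rV[R]_m) - x)%R =
  \int[mu m]_(z in S) k z.
Proof.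
move=> mS mk k0; rewrite integral_mkcond [RHS]integral_mkcond.
rewrite -(integral_row_shift x (f := k \_ S)).
- exact: eq_integral.
- by apply/(measurable_restrictT _ _).1 => //; exact: measurable_funTS.
- by move=> z; exact: erestrict_ge0.
Qed.

(* A point of the complement of the paraboloid [N] is either the reflection of
   a point of [N], or far from the origin, or in the thin slab between the two
   paraboloids [N] and [- N]. *)
Lemma paraboloid_balance m (s rho : R) : (0 < s < 1)%R -> (0 < rho <= 1)%R ->
  exists2 L : R, (0 <= L)%R & forall (a : 'I_m.+1 -> R) j, (1 <= a j)%R ->
  forall k : 'rV[R]_m.+1 -> \bar R, measurable_fun [set: rowspace R m.+1] k ->
  (forall z, 0 <= k z) -> (forall z, k (- z)%R = k z) ->
  (forall z, k z <= (riesz s z)%:E) ->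
  \int[mu m.+1]_(z in ~` paraboloid a rho) k z <=
  \int[mu m.+1]_(z in paraboloid a rho) k z + L%:E.
Proof.
move=> s01 /andP[rho0 rho1]; have s0 : (0 < s)%R by case/andP: s01.
have [L1 L10 far] := kernel_far_le m.+1 s0 rho0.
have [L2 L20 near] := kernel_slab_le m s01.
exists (L1 + L2)%R; first exact: addr_ge0.
move=> a j aj k mk k0 kN kK; set N : set (rowspace R m.+1) := paraboloid a rho.
have mN : measurable (N : set (rowspace R _)) by exact: measurable_paraboloid.
pose N' : set (rowspace R m.+1) := [set z : 'rV[R]_m.+1 | N (- z)%R].
pose T1 : set (rowspace R m.+1) := [set z : 'rV[R]_m.+1 | (rho <= enorm z)%R].
pose T2 : set (rowspace R m.+1) := [set z : 'rV[R]_m.+1 | (enorm z < 1)%R] `&`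
  [set z : 'rV[R]_m.+1 | (`|\sum_(i < m.+1) a i * z ord0 i| <= enorm z ^+ 2)%R].
have mN' : measurable (N' : set (rowspace R _)).
  have := measurable_row_sub (0%R : 'rV[R]_m.+1) measurableT mN.
  by rewrite setTI; congr measurable; apply/seteqP; split => z /=; rewrite sub0r.
have mT1 : measurable T1 by exact: measurable_far.
have mT2 : measurable T2 by exact: measurable_thin_slab.
have sub : ~` N `<=` N' `|` (T1 `|` T2).
  move=> z nNz; have [rz|zr] := leP rho (enorm z); first by right; left.
  have z1 : (enorm z < 1)%R by lra.
  have [sz|] := boolP (`|\sum_(i < m.+1) a i * z ord0 i| <= enorm z ^+ 2)%R.
    by right; right.
  rewrite -ltNge lter_normr => /orP[] h; last by case: nNz; split => //; lra.
  left; split; rewrite enormN//.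
  under eq_bigr do rewrite mxE mulrN; rewrite sumrN; lra.
apply: (@le_trans _ _ (\int[mu m.+1]_(z in N' `|` (T1 `|` T2)) k z)).
  apply: ge0_subset_integral => //; first exact: measurableC.
    by apply: measurableU => //; exact: measurableU.
  exact: measurable_funTS.
have mT12 : measurable (T1 `|` T2 : set (rowspace R _)) by exact: measurableU.
apply: le_trans (ge0_integral_setU_le _ mN' mT12 mk k0) _.
apply: leeD.
  rewrite integral_mkcond [leRHS]integral_mkcond.
  rewrite -(integral_row_reflect (0%R : 'rV[R]_m.+1) (f := k \_ N)).
  - rewrite le_eqVlt; apply/orP; left; apply/eqP; apply: eq_integral => z _.
    by rewrite /patch sub0r kN.
  - by apply/(measurable_restrictT _ _).1 => //; exact: measurable_funTS.
  - by move=> z; exact: erestrict_ge0.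
have mK := @measurable_enorm_powR R m.+1 (- (m.+1%:R + s))%R.
apply: le_trans (ge0_integral_setU_le _ mT1 mT2 mk k0) _.
rewrite EFinD; apply: leeD.
  apply: le_trans far; apply: ge0_le_integral => //.
  - exact: measurable_funTS.
  - exact: measurable_funTS.
apply: le_trans (near a j aj); apply: ge0_le_integral => //.
- exact: measurable_funTS.
- exact: measurable_funTS.
Qed.

End Barrier.

(** * The barrier *)

Section Gain.
Variable R : realType.
Local Notation mu := (row_measure R).

Definition gain_height (c s lam : R) : R := c * (lam / 2) `^ (1 + s).

(** Where coordinate [i0] exceeds [lam / 2], the profile [c * t^(1 + s)] exceeds [gain_height], so
    the box lies under its graph. Boxes for successively halved [lam] are disjoint in direction
    [i0], and the lower bound in direction [j] keeps them above the leaves of low level. *)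
Definition gain_box m (j : 'I_m) (c s lam : R) : set (rowspace R m) :=
  [set z : 'rV[R]_m | forall i,
    (if i == j then gain_height c s lam / 2 else lam / 2) < z ord0 i <
    (if i == j then gain_height c s lam else lam)].

Lemma gain_height_gt0 c s lam : 0 < c -> 0 < lam -> 0 < gain_height c s lam.
Proof. by move=> c0 l0; rewrite mulr_gt0// powR_gt0// divr_gt0. Qed.

(** Keeps the thin side below the others, so that the box fits in the cube of side [lam]. *)
Lemma gain_height_le c s lam : 0 < c <= 1 -> 0 < s -> 0 < lam <= 1 ->
  gain_height c s lam <= lam / 2.
Proof.
move=> /andP[c0 c1] s0 /andP[l0 l1].
have h : (lam / 2) `^ (1 + s) <= lam / 2 by apply: ge1r_powR; lra.
have := powR_ge0 (lam / 2) (1 + s); rewrite /gain_height; nra.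
Qed.

Lemma gain_height_mono c s l1 l2 : 0 < c -> 0 < s -> 0 < l1 -> l1 <= l2 ->
  gain_height c s l1 <= gain_height c s l2.
Proof.
move=> c0 s0 l10 l12; rewrite /gain_height ler_pM2l//.
apply: ge0_ler_powR; rewrite ?nnegrE; lra.
Qed.

Local Open Scope ereal_scope.

Lemma measurable_gain_box m (j : 'I_m) c s lam : measurable (gain_box j c s lam).
Proof. exact: measurable_open_box. Qed.

Lemma gain_box_measure m (j : 'I_m.+1) c s lam : (0 < c)%R -> (0 < lam)%R ->
  mu m.+1 (gain_box j c s lam) = ((lam / 2) ^+ m * (gain_height c s lam / 2))%:E.
Proof.
move=> c0 l0; have h0 := gain_height_gt0 s c0 l0.
rewrite /gain_box row_measure_box; last by move=> i; case: ifP => _; lra.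
congr EFin; rewrite (bigD1 j)//= eqxx mulrC.
rewrite (eq_bigr (fun=> lam / 2)%R); last by move=> i /negbTE ->; lra.
by rewrite prodr_const cardC1 card_ord; congr (_ * _)%R; lra.
Qed.

Definition gain_const m (c s : R) : R :=
  (c / 2 * (2 * m.+1%:R) `^ (- (m%:R + s)))%R.

(** Scale invariance at the critical exponent: the volume is of order [lam^(m + 1 + s)], and the
    kernel is at least of order [lam^(- (m + 1 + s))], since [|y - x|] is at most
    [(m + 1) * lam + lam / 2]. The powers of [lam] cancel. The hypothesis on [M] says that
    truncation is not felt at this distance. *)
Lemma gain_box_integral m (i0 j : 'I_m.+1) (c s lam M : R) (x : 'rV[R]_m.+1)
    (k : 'rV[R]_m.+1 -> \bar R) :
  i0 != j -> (0 < c <= 1)%R -> (0 < s)%R -> (0 < lam <= 1)%R ->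
  (enorm x < lam / 2)%R -> measurable_fun [set: rowspace R m.+1] k ->
  (forall z, 0 <= k z) ->
  ((m.+2%:R * lam) `^ (- (m.+1%:R + s)) <= M)%R ->
  (forall z, (Num.min (riesz s z) M)%:E <= k z) ->
  (gain_const m.+1 c s)%:E <= \int[mu m.+1]_(y in gain_box j c s lam) k (y - x)%R.
Proof.
move=> ij c01 s0 l01 xl mk k0 Mb kM.
have [c0 l0] : (0 < c /\ 0 < lam)%R by case/andP: c01; case/andP: l01.
have hle := gain_height_le c01 s0 l01.
set v := ((m.+2%:R * lam) `^ (- (m.+1%:R + s)))%R in Mb.
have p0 : (0 < m.+1%:R + s)%R by rewrite ltr_wpDl.
have mB := @measurable_gain_box m.+1 j c s lam.
have mkx := measurableT_comp mk (measurable_row_translate x).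
have -> : (gain_const m.+1 c s)%:E = \int[mu m.+1]_(y in gain_box j c s lam) v%:E.
  transitivity (v%:E * mu m.+1 (gain_box j c s lam)); last by rewrite integral_cst.
  rewrite gain_box_measure// -EFinM; congr EFin.
  rewrite /gain_const /v /gain_height.
  have -> : (m.+2%:R * lam = 2 * m.+2%:R * (lam / 2))%R by lra.
  have h0 : (0 < lam / 2)%R by rewrite divr_gt0.
  set h := (lam / 2)%R in h0 *.
  rewrite (powRM _ _ (ltW h0))//.
  have e : (h `^ (- (m.+1%:R + s)) * h ^+ m * h `^ (1 + s) = 1)%R.
    rewrite -powR_mulrn ?ltW// -!powRD; last 2 first.
    - by apply/implyP => _; rewrite gt_eqF.
    - by apply/implyP => _; rewrite gt_eqF.
    have -> : (- (m.+1%:R + s) + m%:R + (1 + s) = 0 :> R)%R by rewrite -natr1; ring.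
    exact: powRr0.
  transitivity (c / 2 * (2 * m.+2%:R) `^ (- (m.+1%:R + s)) *
    (h `^ (- (m.+1%:R + s)) * h ^+ m * h `^ (1 + s)))%R; last by ring.
  by rewrite e mulr1.
apply: ge0_le_integral => //.
- by move=> y _; rewrite lee_fin powR_ge0.
- exact: measurable_funTS.
move=> y By; apply: le_trans (kM _); rewrite lee_fin le_min Mb andbT.
have yl i : (`|y ord0 i| < lam)%R.
  have := By i; have := gain_height_gt0 s c0 l0.
  by case: ifP => _ ? /andP[? ?]; rewrite ltr_norml; apply/andP; split; lra.
have yx : (enorm (y - x) <= m.+2%:R * lam)%R.
  apply: le_trans (enormD _ _) _; rewrite enormN -natr1 mulrDl mul1r.
  by apply: lerD; [exact: enorm_lt_coord|lra].
(* Required because the kernel is [0] at the origin. Coordinate [i0] separates the two points: it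
   exceeds [lam / 2] on the box and stays below it at [x]. *)
have yx0 : (0 < enorm (y - x))%R.
  rewrite lt_def enorm_ge0 andbT; apply/eqP => /enorm_eq0 /eqP.
  rewrite subr_eq0 => /eqP yE; have := By i0; rewrite (negbTE ij) yE.
  by have := coord_enorm x i0; rewrite ler_norml => /andP[_ ?] /andP[? _]; lra.
rewrite /riesz /v !powRN lef_pV2 ?posrE ?powR_gt0 ?mulr_gt0//.
by apply: ge0_ler_powR => //; rewrite ?nnegrE; apply: ltW => //; rewrite mulr_gt0.
Qed.

(** Recentring [z j + |z|^2] at [b] changes only the linear part, so every point of every leaf sees
    a [paraboloid]. *)
Lemma paraboloid_level m (j : 'I_m) (b z : 'rV[R]_m) :
  ((b + z)%R ord0 j + enorm (b + z) ^+ 2 - (b ord0 j + enorm b ^+ 2) =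
   \sum_(i < m) ((i == j)%:R + 2 * b ord0 i) * z ord0 i + enorm z ^+ 2)%R.
Proof.
rewrite !enormE mxE.
have -> : (z ord0 j = \sum_(i < m) (i == j)%:R * z ord0 i)%R.
  rewrite (bigD1 j)//= eqxx mul1r big1 ?addr0// => i /negbTE ->.
  by rewrite mul0r.
rewrite (_ : forall p q r t : R, p + q + r - (p + t) = q + (r - t))%R; last by move=> *; ring.
rewrite -sumrB -!big_split/=; apply: eq_bigr => i _; rewrite mxE; ring.
Qed.

(* The sublevel sets of [z j + |z - X0|^2], completed by the gain set [Q],
   have negative nonlocal mean curvature at the points [x] of low level. *)
Definition balanced m (j : 'I_m.+1) (s rho d0 M : R) (Q : set (rowspace R m.+1)) : Prop :=
  forall X0 x : 'rV[R]_m.+1, (0 <= (x - X0) ord0 j)%R ->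
  ((x - X0) ord0 j + enorm (x - X0) ^+ 2 < d0)%R ->
  forall k : 'rV[R]_m.+1 -> \bar R, measurable_fun [set: rowspace R m.+1] k ->
  (forall z, 0 <= k z) -> (forall z, k (- z)%R = k z) ->
  (forall z, k z <= (riesz s z)%:E) ->
  (forall z, (Num.min (riesz s z) M)%:E <= k z) ->
  forall W : set (rowspace R m.+1), measurable W ->
  (forall y : 'rV[R]_m.+1, Q (y - X0)%R -> W y) ->
  (forall y : 'rV[R]_m.+1, (enorm (y - x) < rho)%R ->
    ((y - X0) ord0 j + enorm (y - X0) ^+ 2 <
     (x - X0) ord0 j + enorm (x - X0) ^+ 2)%R -> W y) ->
  \int[mu m.+1]_(y in ~` W) k (y - x)%R + 1 <=
  \int[mu m.+1]_(y in W) k (y - x)%R.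

(* [c |z'|^(1+s)] is the critical profile: each dyadic box under its graph
   carries the same amount [gain_const] of kernel mass, so finitely many boxes
   beat any bounded curvature loss. *)
Lemma barrier_balance m (i0 j : 'I_m.+1) (s rho c lam0 : R) :
  i0 != j -> (0 < s < 1)%R -> (0 < rho <= 1)%R -> (0 < c <= 1)%R ->
  (0 < lam0 <= 1)%R ->
  exists d0 M : R, exists Q : set (rowspace R m.+1),
  [/\ (0 < d0)%R, measurable Q,
    forall z, Q z -> [/\ (forall i, (0 < (z : 'rV[R]_m.+1) ord0 i < lam0)%R),
      (d0 < (z : 'rV[R]_m.+1) ord0 j)%R &
      ((z : 'rV[R]_m.+1) ord0 j < c * (z : 'rV[R]_m.+1) ord0 i0 `^ (1 + s))%R] &
    balanced j s rho d0 M Q].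
Proof.
move=> ij s01 rho01 c01 l01.
have [s0 s1] : (0 < s /\ s < 1)%R by apply/andP.
have [c0 c1] : (0 < c /\ c <= 1)%R by apply/andP.
have [l0 l1] : (0 < lam0 /\ lam0 <= 1)%R by apply/andP.
have [L L0 loss] := paraboloid_balance m s01 rho01.
pose kap := gain_const m.+1 c s.
have kap0 : (0 < kap)%R.
  by rewrite /kap mulr_gt0 ?divr_gt0// powR_gt0// mulr_gt0.
(* Enough boxes to pay for the curvature loss [L] and leave the margin [1] required by
   [balanced]. *)
have [q1 q1L] : exists q1 : nat, (L + 1 <= kap * q1%:R)%R.
  exists (Num.truncn ((L + 1) / kap)).+1.
  by rewrite mulrC -ler_pdivrMr// ltW// truncnS_gt.
pose lam q : R := (lam0 * 2^-1 ^+ q)%R.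
have lamS q : lam q.+1 = (lam q / 2)%R by rewrite /lam exprSr mulrA.
have lam_gt0 q : (0 < lam q)%R by rewrite mulr_gt0// exprn_gt0.
have lam_mono q q' : (q <= q')%N -> (lam q' <= lam q)%R.
  move=> /subnKC <-; elim: (q' - q)%N => [|d IH]; first by rewrite addn0.
  by rewrite addnS lamS; have := lam_gt0 (q + d)%N; lra.
have lam_le q : (lam q <= lam0)%R.
  by have := lam_mono 0%N q (leq0n q); rewrite {2}/lam expr0 mulr1.
have lam01 q : (0 < lam q <= 1)%R by rewrite lam_gt0 (le_trans (lam_le q)).
pose Q := \big[setU/set0]_(q < q1) gain_box j c s (lam q).
have QP z : Q z -> exists2 q, (q < q1)%N & gain_box j c s (lam q) z.
  by rewrite /Q -(bigcup_mkord q1 (fun q => gain_box j c s (lam q))) => -[q /= qq1 Bz]; exists q.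
(* The first bound puts every box above level [d0]; the second forces [|x - X0| < lam q1 / 2], so
   that [x] is close to the origin at the scale of every box. *)
pose d0 : R := Num.min (gain_height c s (lam q1) / 2)%R ((lam q1 / 2) ^+ 2)%R.
have d00 : (0 < d0)%R.
  by rewrite lt_min divr_gt0 ?gain_height_gt0//= exprn_gt0// divr_gt0.
(* The kernel at the scale [lam q1], smaller than that of any box used: a truncation above this
   value keeps the gain of each box. *)
pose M := ((m.+2%:R * lam q1) `^ (- (m.+1%:R + s)))%R.
have mQ : measurable Q by apply: bigsetU_measurable => q _; exact: measurable_gain_box.
have Qd z : Q z -> (d0 < (z : 'rV[R]_m.+1) ord0 j)%R.
  move=> /QP[q qq1 /(_ j)]; rewrite eqxx => /andP[+ _].
  apply: le_lt_trans; apply: (@le_trans _ _ (gain_height c s (lam q1) / 2)%R).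
    by rewrite ge_min lexx.
  by rewrite ler_pM2r// gain_height_mono// lam_mono// ltnW.
exists d0, M, Q; split => //.
  move=> z Qz; split; last 2 first.
  - exact: Qd.
  - have [q qq1 Bz] := QP z Qz.
    have := Bz j; rewrite eqxx => /andP[_ zh]; apply: lt_le_trans zh _.
    rewrite ler_pM2l//; apply: ge0_ler_powR; rewrite ?nnegrE; [lra| | |].
    + by rewrite ltW// divr_gt0.
    + have := Bz i0; rewrite (negbTE ij) => /andP[+ _].
      by have := lam_gt0 q; lra.
    + by have := Bz i0; rewrite (negbTE ij) => /andP[+ _]; exact: ltW.
  move=> i; have [q qq1 /(_ i)] := QP z Qz.
  have := gain_height_gt0 s c0 (lam_gt0 q).
  have := gain_height_le c01 s0 (lam01 q); have := lam_le q; have := lam_gt0 q.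
  by case: ifP => _; move: (_ ord0 i) => t ? ? ? ? /andP[? ?]; apply/andP; split; lra.
move=> X0 x xj xd k mk k0 kN kK kM W mW WQ WN.
set b := (x - X0)%R in xj xd WN.
pose a i : R := ((i == j)%:R + 2 * b ord0 i)%R.
(* The sign condition [0 <= (x - X0) ord0 j] is what bounds the gradient of the leaf from below in
   direction [j]. *)
have aj : (1 <= a j)%R by rewrite /a eqxx /= lerDl mulr_ge0.
pose N : set (rowspace R m.+1) := paraboloid a rho.
have mN : measurable N by exact: measurable_paraboloid.
pose NY : set (rowspace R m.+1) := [set y | N ((y : 'rV[R]_m.+1) - x)%R].
pose QY : set (rowspace R m.+1) := [set y | Q ((y : 'rV[R]_m.+1) - X0)%R].
have mNY : measurable NY by have := @measurable_row_translate R _ x measurableT N mN; rewrite setTI.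
have mQY : measurable QY by have := @measurable_row_translate R _ X0 measurableT Q mQ; rewrite setTI.
have mkx := measurableT_comp mk (measurable_row_translate x).
have level y : ((y - X0) ord0 j + enorm (y - X0) ^+ 2 - (b ord0 j + enorm b ^+ 2) =
   \sum_(i < m.+1) a i * (y - x) ord0 i + enorm (y - x) ^+ 2)%R.
  have yb : (b + (y - x) = y - X0)%R by rewrite /b addrC addrA subrK.
  by rewrite -paraboloid_level yb.
have NW : NY `<=` W.
  by move=> y [y1 y2]; apply: WN => //; move: y2; rewrite -level subr_lt0.
(* Gain and paraboloid are not counted twice: points of [QY] have level above [d0], points of [NY]
   have level below that of [x]. *)
have NQ0 : [disjoint NY & QY].
  rewrite disj_set2E; apply/eqP/seteqP; split => // y [[_ +] /Qd yd].
  by rewrite -level; have := sqr_ge0 (enorm ((y : 'rV[R]_m.+1) - X0)); lra.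
apply: (@le_trans _ _ (\int[mu m.+1]_(y in NY) k ((y : 'rV[R]_m.+1) - x)%R +
    \int[mu m.+1]_(y in QY) k ((y : 'rV[R]_m.+1) - x)%R)); last first.
  rewrite -ge0_integral_setU//; last exact: measurable_funTS.
  apply: ge0_subset_integral => //.
  - exact: measurableU.
  - exact: measurable_funTS.
  by move=> y [/NW//|]; exact: WQ.
apply: (@le_trans _ _ (\int[mu m.+1]_(z in N) k z + L%:E + 1)).
  apply: leeD => //; apply: le_trans (loss a j aj k mk k0 kN kK).
  have mCN : measurable (~` N) by exact: measurableC.
  rewrite -[leRHS](integral_row_translate x mCN mk k0).
  apply: ge0_subset_integral => //.
  - exact: measurableC.
  - exact: measurableC.
  - exact: measurable_funTS.
  - by move=> y /= + /NW; exact.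
rewrite -(integral_row_translate x mN mk k0) -addeA; apply: leeD => //.
apply: (@le_trans _ _ (kap * q1%:R)%:E); first by rewrite -EFinD lee_fin.
have -> : \int[mu m.+1]_(y in QY) k ((y : 'rV[R]_m.+1) - x)%R =
    \int[mu m.+1]_(y in Q) k ((y : 'rV[R]_m.+1) - b)%R.
  rewrite -(@integral_row_translate R m.+1 X0 Q (fun y => k (y - b)%R) mQ)//.
  - by apply: eq_integral => y _; congr k; rewrite /b opprB addrA subrK.
  - exact: (measurableT_comp mk (measurable_row_translate b)).
rewrite /Q ge0_integral_bigsetU//=; first last.
- by apply: measurable_funTS; exact: (measurableT_comp mk (measurable_row_translate b)).
- have dis (q q' : nat) z : (q < q')%N -> gain_box j c s (lam q) z ->
      gain_box j c s (lam q') z -> False.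
    move=> /lam_mono; rewrite lamS => h /(_ i0) + /(_ i0).
    rewrite (negbTE ij); move: (_ ord0 i0) => t /andP[? ?] /andP[? ?]; lra.
  apply/trivIsetP => q q' _ _ qq'; apply/seteqP; split => // z [Bz Bz'].
  case: (ltngtP q q') => [h|h|/val_inj h].
  - exact: dis h Bz Bz'.
  - exact: dis h Bz' Bz.
  - by rewrite h eqxx in qq'.
- exact: index_enum_uniq.
- by move=> q; exact: measurable_gain_box.
have -> : (kap * q1%:R)%:E = \sum_(q < q1) kap%:E.
  by rewrite sumEFin sumr_const card_ord mulr_natr.
have bq : (enorm b < lam q1 / 2)%R.
  rewrite -(@ltr_pXn2r _ 2)// ?nnegrE ?enorm_ge0//; last by rewrite ltW// divr_gt0.
  have : (d0 <= (lam q1 / 2) ^+ 2)%R by rewrite ge_min lexx orbT.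
  lra.
apply: lee_sum => q _; have qq1 : (lam q1 <= lam q)%R by rewrite lam_mono// ltnW.
apply: (@gain_box_integral m i0 j c s (lam q) M b k) => //; first by lra.
rewrite /M !powRN lef_pV2 ?posrE ?powR_gt0 ?mulr_gt0//.
apply: ge0_ler_powR; rewrite ?nnegrE ?addr_ge0 ?mulr_ge0 ?ler0n//; try exact: ltW.
by rewrite ler_pM2l.
Qed.

End Gain.

(** * Calibration and perimeter *)

Section Interaction.
Local Open Scope ereal_scope.
Context d (T : measurableType d) (R : realType).
Variable mu : {sigma_finite_measure set T -> \bar R}.

Definition interaction (k : T * T -> \bar R) (A B : set T) : \bar R :=
  \int[mu \x mu]_(z in A `*` B) k z.

Variable k : T * T -> \bar R.
Hypotheses (mk : measurable_fun setT k) (k0 : forall z, 0 <= k z).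
Local Notation I := (interaction k).

Lemma interaction_ge0 A B : 0 <= I A B.
Proof. exact: integral_ge0. Qed.

Lemma interactionUr A B B' : measurable A -> measurable B -> measurable B' ->
  B `&` B' = set0 -> I A (B `|` B') = I A B + I A B'.
Proof.
move=> mA mB mB' BB'; rewrite /interaction.
have -> : A `*` (B `|` B') = (A `*` B) `|` (A `*` B').
  apply/seteqP; split => -[x y] /=; first by case=> ? [?|?]; [left|right].
  by case=> -[? ?]; split => //; [left|right].
rewrite ge0_integral_setU//; try exact: measurableX.
- exact: measurable_funTS.
- rewrite disj_set2E; apply/eqP/seteqP; split => // -[x y] [[/= _ By] [_ B'y]].
  by have : (B `&` B') y by []; rewrite BB'.
Qed.

Lemma section_integralE (S : set (T * T)) x :
  \int[mu]_(y in [set y | S (x, y)]) k (x, y) = fubini_F mu (k \_ S) x.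
Proof. by rewrite integral_mkcond. Qed.

Lemma measurable_section_integral (S : set (T * T)) : measurable S ->
  measurable_fun setT (fun x => \int[mu]_(y in [set y | S (x, y)]) k (x, y)).
Proof.
move=> mS; under eq_fun do rewrite section_integralE.
apply: measurable_fun_fubini_tonelli_F.
- by apply/(measurable_restrictT _ _).1 => //; exact: measurable_funTS.
- by move=> z; exact: erestrict_ge0.
Qed.

Lemma integral_sections (A : set T) (S : set (T * T)) : measurable A -> measurable S ->
  \int[mu \x mu]_(z in (A `*` setT) `&` S) k z =
  \int[mu]_(x in A) \int[mu]_(y in [set y | S (x, y)]) k (x, y).
Proof.
move=> mA mS.
have mAS : measurable ((A `*` setT) `&` S) by apply: measurableI => //; exact: measurableX.
rewrite integral_mkcond fubini_tonelli1; first last.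
- by move=> z; exact: erestrict_ge0.
- by apply/(measurable_restrictT _ _).1 => //; exact: measurable_funTS.
rewrite [RHS]integral_mkcond; apply: eq_integral => x _.
rewrite -section_integralE /patch; case: ifPn => [/set_mem Ax|/negP Ax].
  by congr integral; apply/seteqP; split => y /=; [case|].
rewrite (_ : [set y | _] = set0) ?integral_set0//.
by apply/seteqP; split => // y [[/= Axx _] _]; apply: Ax; rewrite inE.
Qed.

Lemma integral_prod_swap (f : T * T -> \bar R) :
  measurable_fun setT f -> (forall z, 0 <= f z) ->
  \int[mu \x mu]_z f (z.2, z.1) = \int[mu \x mu]_z f z.
Proof.
move=> mf f0.
have ms : measurable_fun setT (fun z : T * T => f (z.2, z.1)).
  apply: (measurableT_comp mf); apply: measurable_fun_pair.
  - exact: measurable_snd.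
  - exact: measurable_fst.
rewrite fubini_tonelli1// fubini_tonelli1//.
exact: (esym (@fubini_tonelli _ _ _ _ _ mu mu f mf f0)).
Qed.

Hypothesis ksym : forall x y, k (x, y) = k (y, x).

(* [W x] plays the role of the sublevel set through [x] of a foliation: by
   antisymmetry of [W] the self-interaction of [A] cancels, and only the
   interactions of [A] with [C] and [D] remain. *)
Lemma calibration (A C D : set T) (W : set (T * T)) (M : R) :
  measurable A -> measurable C -> measurable D -> measurable W ->
  mu A < +oo -> (forall z, k z <= M%:E) ->
  (forall x, A x -> \int[mu]_(y in ~` [set y | W (x, y)]) k (x, y) + 1 <=
     \int[mu]_(y in [set y | W (x, y)]) k (x, y)) ->
  (forall x y, A x -> A y -> W (x, y) -> ~ W (y, x)) ->
  (forall x y, A x -> W (x, y) -> A y \/ C y) ->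
  (forall x y, A x -> D y -> ~ W (x, y)) -> A `&` D = set0 ->
  I A D + mu A <= I A C.
Proof.
move=> mA mC mD mW Afin kM curv anti WC WD AD.
pose J S := \int[mu \x mu]_(z in S) k z.
have mAT : measurable (A `*` [set: T]) by exact: measurableX.
have mAA : measurable (A `*` A) by exact: measurableX.
have mCW : measurable (~` W) by exact: measurableC.
have mAW : measurable ((A `*` A) `&` W) by exact: measurableI.
have mAW' : measurable ((A `*` A) `&` ~` W) by exact: measurableI.
(* The curvature inequality integrated over [A]; its margin [1] becomes [mu A]. *)
have step1 : J ((A `*` setT) `&` ~` W) + mu A <= J ((A `*` setT) `&` W).
  rewrite /J !integral_sections//.
  have -> : mu A = \int[mu]_(x in A) cst 1 x by rewrite integral_cst// mul1e.
  rewrite -ge0_integralD//; first last.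
  - by apply: measurable_funTS; exact: (measurable_section_integral mCW).
  - by move=> x _; exact: integral_ge0.
  apply: ge0_le_integral => //.
  - by move=> x _; rewrite adde_ge0// integral_ge0.
  - apply: emeasurable_funD => //.
    by apply: measurable_funTS; exact: (measurable_section_integral mCW).
  - by apply: measurable_funTS; exact: (measurable_section_integral mW).
have step2 : J ((A `*` setT) `&` W) <= J ((A `*` A) `&` W) + I A C.
  have mAC : measurable (A `*` C) by exact: measurableX.
  apply: le_trans (ge0_integral_setU_le _ mAW mAC mk k0).
  apply: ge0_subset_integral => //.
  - exact: measurableI.
  - exact: measurableU.
  - exact: measurable_funTS.
  by move=> [x y] [[/= Ax _] Wxy]; have [?|?] := WC x y Ax Wxy; [left|right].
(* [W] never leads from [A] to [D], so all of [A] times [D] is counted on the side of the complement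
   of [W]. *)
have step3 : J ((A `*` A) `&` ~` W) + I A D <= J ((A `*` setT) `&` ~` W).
  have mADm : measurable (A `*` D) by exact: measurableX.
  rewrite /J /interaction -ge0_integral_setU//; last 2 first.
  - exact: measurable_funTS.
  - rewrite disj_set2E; apply/eqP/seteqP; split => // -[x y] [[[/= _ Ay] _] [_ Dy]].
    by have : (A `&` D) y by []; rewrite AD.
  apply: ge0_subset_integral => //.
  - exact: measurableU.
  - exact: measurableI.
  - exact: measurable_funTS.
  by move=> [x y] [[[/= Ax Ay] nW]//|[/= Ax Dy]]; split => //; exact: WD.
(* Exchanging the two points preserves the kernel and, by antisymmetry, carries [W] into its
   complement inside [A] times [A]. *)
have step4 : J ((A `*` A) `&` W) <= J ((A `*` A) `&` ~` W).
  have mkW : measurable_fun setT (k \_ ((A `*` A) `&` W)).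
    by apply/(measurable_restrictT _ _).1 => //; exact: measurable_funTS.
  rewrite /J integral_mkcond [leRHS]integral_mkcond -integral_prod_swap//; last first.
    by move=> z; exact: erestrict_ge0.
  apply: ge0_le_integral => //.
  - by move=> z _; exact: erestrict_ge0.
  - apply: (measurableT_comp mkW); apply: measurable_fun_pair.
    + exact: measurable_snd.
    + exact: measurable_fst.
  - by apply/(measurable_restrictT _ _).1 => //; exact: measurable_funTS.
  move=> [x y] _; rewrite /patch /=; case: ifPn => [/set_mem [[/= Ay Ax] Wyx]|_].
    have S'xy : ((A `*` A) `&` ~` W) (x, y).
      by split => // Wxy; exact: (anti x y).
    by rewrite (mem_set S'xy) (ksym x y).
  by case: ifPn.
(* Here the bounded kernel is essential: the self-interaction is at most [M * mu A * mu A], so it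
   can be subtracted from both sides. *)
have fin : J ((A `*` A) `&` W) \is a fin_num.
  rewrite ge0_fin_numE; last exact: integral_ge0.
  apply: (@le_lt_trans _ _ (\int[mu \x mu]_(z in A `*` A) M%:E)).
    apply: (@le_trans _ _ (\int[mu \x mu]_(z in A `*` A) k z)).
      by apply: ge0_subset_integral => //; exact: measurable_funTS.
    apply: ge0_le_integral => //; first exact: measurable_funTS.
  rewrite integral_cst//=.
  have -> : (mu \x mu) (A `*` A) = mu A * mu A by exact: product_measure1E.
  have /fineK <- : mu A \is a fin_num by rewrite ge0_fin_numE.
  by rewrite -!EFinM ltry.
rewrite -(leeD2lE _ _ fin).
apply: le_trans step2; apply: le_trans step1.
rewrite addeA; apply: leeD => //; apply: le_trans step3.
exact: leeD.
Qed.

End Interaction.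

(** * The perimeter as a sum of interactions *)

Section Energy.
Variables (R : realType) (m : nat) (s : R).
Local Notation V := (rowspace R m).
Local Notation mu := (row_measure R m).
Local Open Scope ereal_scope.

Definition riesz_pair (z : V * V) : \bar R :=
  (riesz s ((z.1 : 'rV[R]_m) - (z.2 : 'rV[R]_m)))%:E.

Local Notation I := (interaction mu riesz_pair).

Lemma riesz_pair_ge0 z : 0 <= riesz_pair z.
Proof. by rewrite lee_fin powR_ge0. Qed.

Lemma measurable_riesz_pair : measurable_fun setT riesz_pair.
Proof.
exact: (measurableT_comp (@measurable_enorm_powR R m (- (m%:R + s))) (@measurable_sub_pair R m)).
Qed.

Lemma lnullP (N : set 'rV[R]_m) : borel N -> lnull N <-> mu N = 0.
Proof.
have volE (M : set 'rV[R]_m) : borel M -> vol M = mu M.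
  move=> bM; rewrite /vol iintE//.
  - exact: integral_row_indic.
  - exact/measurable_EFinP.
move=> bN; split=> [[M [bM M0 NM]]|N0]; last first.
  by exists N; split => //; rewrite volE.
apply/eqP; rewrite -measure_le0 -M0 volE//.
by apply: le_measure; rewrite ?inE.
Qed.

Lemma LsE (A B : set V) : measurable A -> measurable B -> Ls s A B = I A B.
Proof.
move=> mA mB; rewrite /Ls /interaction.
pose h (z : V * V) : \bar R :=
  (\1_A z.1 * \1_B z.2 * riesz s ((z.1 : 'rV[R]_m) - (z.2 : 'rV[R]_m)))%:E.
have mh : measurable_fun setT h.
  apply/measurable_EFinP; apply: measurable_funM; last first.
    by apply/measurable_EFinP; exact: measurable_riesz_pair.
  apply: measurable_funM.
  - exact: (measurableT_comp (measurable_indic mA) measurable_fst).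
  - exact: (measurableT_comp (measurable_indic mB) measurable_snd).
have h0 z : 0 <= h z by rewrite lee_fin !mulr_ge0 ?powR_ge0.
rewrite integral_mkcond.
rewrite [RHS](_ : _ = \int[mu \x mu]_z h z); last first.
  apply: eq_integral => -[x y] _; rewrite /patch /h /riesz_pair /=.
  rewrite !indicE; case: ifPn => [/set_mem[/= Ax By]|xy].
    by rewrite !mem_set// !mul1r.
  have [Ax|] := boolP (x \in A); last by rewrite !mul0r.
  have [By|] := boolP (y \in B); last by rewrite mulr0 mul0r.
  move/negP : xy => []; rewrite inE; split => /=; exact: set_mem.
rewrite fubini_tonelli1//.
rewrite (_ : (fun x => iint _) = fubini_F mu h); last first.
  apply/funext => x; rewrite iintE//.
  - exact: (measurable_fun_pair2 x mh).
  - by move=> y; exact: (h0 (x, y)).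
rewrite iintE//; first exact: measurable_fun_fubini_tonelli_F.
by move=> x; exact: integral_ge0.
Qed.

(** The excess lies in two strips over null sets. They have product measure zero even if the whole
    space has infinite measure, by the convention [0 * +oo = 0]. *)
Lemma interaction_null_le (A A' B B' : set V) :
  measurable A -> measurable A' -> measurable B -> measurable B' ->
  mu (A `\` A') = 0 -> mu (B `\` B') = 0 -> I A B <= I A' B'.
Proof.
move=> mA mA' mB mB' NA NB.
have mAB := measurableX mA mB; have mAB' := measurableX mA' mB'.
have mN1 : measurable ((A `\` A') `*` [set: V]) by apply: measurableX => //; exact: measurableD.
have mN2 : measurable ([set: V] `*` (B `\` B')) by apply: measurableX => //; exact: measurableD.
have mN : measurable ((A `\` A') `*` [set: V] `|` [set: V] `*` (B `\` B')) by exact: measurableU.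
have N10 : (mu \x mu) ((A `\` A') `*` [set: V]) = 0.
  transitivity (mu (A `\` A') * mu setT); last by rewrite NA mul0e.
  by apply: product_measure1E => //; exact: measurableD.
have N20 : (mu \x mu) ([set: V] `*` (B `\` B')) = 0.
  transitivity (mu setT * mu (B `\` B')); last by rewrite NB mule0.
  by apply: product_measure1E => //; exact: measurableD.
have N0 : (mu \x mu) ((A `\` A') `*` [set: V] `|` [set: V] `*` (B `\` B')) = 0.
  apply/eqP; rewrite -measure_le0; apply: le_trans (measureU2 _ mN1 mN2) _.
  by rewrite -(adde0 0) -{1}N10 -N20.
rewrite /interaction (ge0_negligible_integral mN mAB)//; last 2 first.
- by apply: measurable_funTS; exact: measurable_riesz_pair.
- by move=> *; exact: riesz_pair_ge0.
apply: ge0_subset_integral => //.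
- exact: measurableD.
- by apply: measurable_funTS; exact: measurable_riesz_pair.
- by move=> *; exact: riesz_pair_ge0.
move=> [x y] [[/= Ax By] nN]; split => /=; apply: contrapT => h; apply: nN.
- by left.
- by right.
Qed.

(** Used in both directions, it makes the perimeter independent of the Borel representative, so the
    infimum in [Per] can be read off on a chosen one. *)
Lemma Per_borel_null_le (B B' U : set V) :
  measurable B -> measurable B' -> measurable U ->
  mu (B `\` B') = 0 -> mu (B' `\` B) = 0 -> Per_borel s B U <= Per_borel s B' U.
Proof.
move=> mB mB' mU N1 N2.
have null0 (X X' : set V) Y : measurable X -> measurable X' -> measurable Y ->
    mu (X `\` X') = 0 -> mu ((X `&` Y) `\` (X' `&` Y)) = 0.
  move=> mX mX' mY N; apply/eqP; rewrite -measure_le0 -N; apply: le_measure; rewrite ?inE.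
  - by apply: measurableD; exact: measurableI.
  - exact: measurableD.
  - by move=> x [[Xx Yx] h]; split => // X'x; apply: h.
have N2' : mu (~` B `\` ~` B') = 0.
  by rewrite -N2; congr (row_measure R m _); rewrite !setDE setCK setIC.
have [mCB mCB' mCU] : [/\ measurable (~` B), measurable (~` B') & measurable (~` U)].
  by split; exact: measurableC.
rewrite /Per_borel !LsE; try exact: measurableI.
by apply: leeD; [apply: leeD|]; apply: interaction_null_le; try exact: measurableI; exact: null0.
Qed.

(* Competitor: remove all of [B `&` U]. *)
Lemma removal_inequality (B U : set V) : measurable B -> measurable U ->
  Per_borel s B U < +oo -> Per_borel s B U <= Per_borel s (B `\` U) U ->
  I (B `&` U) (~` B) <= I (B `&` U) (B `\` U) /\ I (B `&` U) (~` B) < +oo.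
Proof.
move=> mB mU Pfin Ple.
have mk := measurable_riesz_pair; have k0 := riesz_pair_ge0.
have mCB : measurable (~` B) by exact: measurableC.
have mCU : measurable (~` U) by exact: measurableC.
set A := B `&` U.
have mA : measurable A by exact: measurableI.
have mD : measurable (B `\` U) by exact: measurableD.
have m1 : measurable (~` B `&` U) by exact: measurableI.
have m2 : measurable (~` B `&` ~` U) by exact: measurableI.
have sym (X Y : set V) : measurable X -> measurable Y -> I X Y = I Y X.
  move=> mX mY; rewrite /interaction integral_mkcond [RHS]integral_mkcond.
  have mkXY : measurable_fun setT (riesz_pair \_ (X `*` Y)).
    apply/(measurable_restrictT _ _).1; first exact: measurableX.
    exact: measurable_funTS.
  have kXY0 z : 0 <= (riesz_pair \_ (X `*` Y)) z by apply: erestrict_ge0.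
  rewrite -(integral_prod_swap mu mkXY kXY0).
  apply: eq_integral => -[x y] _; rewrite /patch /riesz_pair /= /riesz enormB.
  congr (if _ then _ else _); apply/idP/idP => /set_mem[/= ? ?];
    by rewrite inE; split.
(* Before removal [A] interacts with the complement of [B], afterwards with [B] outside [U]. The
   remaining term is the same in both perimeters and finite, hence cancels. *)
have PB : Per_borel s B U = I A (~` B) + I (B `\` U) (~` B `&` U).
  rewrite /Per_borel !LsE//; try exact: measurableI.
  rewrite -interactionUr//.
    by congr (interaction _ _ _ _ + _); rewrite -setIUr setUv setIT.
  by rewrite setIACA setICr setI0.
have PF : Per_borel s (B `\` U) U = I A (B `\` U) + I (B `\` U) (~` B `&` U).
  have e0 : (B `\` U) `&` U = set0 by rewrite setDE -setIA setICl setI0.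
  have e1 : (B `\` U) `&` ~` U = B `\` U by rewrite setDE -setIA setIid.
  have e2 : ~` (B `\` U) `&` U = A `|` (~` B `&` U).
    rewrite /A -setIUl setUv setTI; apply/seteqP; split => x; first by case.
    by move=> Ux; split => // -[_]; exact.
  have mCD : measurable (~` (B `\` U)) by exact: measurableC.
  have I0 X : I set0 X = 0 by rewrite /interaction set0X integral_set0.
  rewrite /Per_borel e0 e1 e2 !LsE//; try exact: measurableI; try exact: measurableU.
  rewrite !I0 !add0e interactionUr//; first by rewrite (sym A).
  by rewrite /A setIACA setICr set0I.
have Pfin2 : I (B `\` U) (~` B `&` U) \is a fin_num.
  rewrite ge0_fin_numE; last exact: interaction_ge0.
  by apply: le_lt_trans Pfin; rewrite PB leeDr// interaction_ge0.
split; first by move: Ple; rewrite PB PF leeD2rE.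
by apply: le_lt_trans Pfin; rewrite PB leeDl// interaction_ge0.
Qed.

End Energy.

(** * Minimality on a Borel representative, and removal of the truncation *)

Section Minimality.
Variables (R : realType) (m : nat) (s : R).
Local Notation V := (rowspace R m).
Local Notation mu := (row_measure R m).
Local Open Scope ereal_scope.

Lemma lnull_sub (N N' : set 'rV[R]_m) : lnull N' -> N `<=` N' -> lnull N.
Proof. by move=> [M [bM M0 NM]] NN'; exists M; split => // x /NN' /NM. Qed.

Lemma lnullU (N N' : set 'rV[R]_m) : lnull N -> lnull N' -> lnull (N `|` N').
Proof.
move=> [M [bM M0 NM]] [M' [bM' M'0 NM']].
have null (X : set 'rV[R]_m) : borel X -> vol X = 0 -> mu X = 0.
  by move=> bX X0; apply/(lnullP bX); exists X; split.
have bMM' : borel (M `|` M') by exact: (@measurableU _ V).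
apply: (@lnull_sub _ (M `|` M')); last by move=> x [/NM|/NM']; [left|right].
apply/(lnullP bMM')/eqP; rewrite -measure_le0.
apply: le_trans (@measureU2 _ _ _ mu M M' _ _) _ => //.
by rewrite -(adde0 0) -{1}(null _ bM M0) -(null _ bM' M'0).
Qed.

(** Since [E] misses [P], removing [P] from a representative changes it by a null set only.
    Disjointness from [P] then holds at every point, as the calibration demands. *)
Lemma minimal_removal (E P U : set 'rV[R]_m) :
  borel P -> borel U -> P `&` E = set0 -> s_minimal_bdd s E U ->
  exists B : set V, [/\ measurable B, lnull (E `\` B), B `&` P = set0,
    interaction mu (@riesz_pair R m s) (B `&` U) (~` B) <=
    interaction mu (@riesz_pair R m s) (B `&` U) (B `\` U) &
    interaction mu (@riesz_pair R m s) (B `&` U) (~` B) < +oo].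
Proof.
move=> bP bU PE [_ Pfin Pmin].
have [_ [B0 [bB0 N0] <-] P0fin] := ereal_inf_lt Pfin.
pose B : set V := B0 `\` P.
have mB : measurable B by exact: measurableD.
have PnE x : P x -> ~ E x by move=> Px Ex; have : (P `&` E) x by []; rewrite PE.
have NB : lnull ((E `\` B) `|` (B `\` E)).
  apply: lnull_sub N0 _ => x [[Ex nB]|[[B0x _] nE]]; last by right.
  by left; split => // B0x; apply: nB; split => // /PnE.
have null0 (X : set V) : measurable X -> X `<=` (E `\` B0) `|` (B0 `\` E) -> mu X = 0.
  by move=> mX XN; apply/(lnullP mX); exact: lnull_sub N0 XN.
exists B.
have [| |h1 h2] := @removal_inequality R m s B U mB bU.
- apply: le_lt_trans P0fin; apply: Per_borel_null_le => //.
  + by rewrite (_ : _ `\` _ = set0) ?measure0//; apply/seteqP; split => // x [[]].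
  + apply: null0; first exact: measurableD.
    by move=> x [B0x nB]; right; split => // Ex; apply: nB; split => // /PnE.
- have mBU : measurable (B `\` U) by exact: measurableD.
  have NF : lnull (((E `\` U) `\` (B `\` U)) `|` ((B `\` U) `\` (E `\` U))).
    apply: lnull_sub NB _ => x [[[Ex nU] nB]|[[Bx nU] nE]].
      by left; split => // Bx; exact: nB.
    by right; split => // Ex; exact: nE.
  (* The perimeter of [B] is a lower bound for all representatives of [E], and the Borel set [B]
     minus [U] represents the competitor [E] minus [U]. *)
  apply: (@le_trans _ _ (Per s E U)).
    apply: le_ereal_inf_tmp => _ [B' [bB' NB'] <-]; apply: Per_borel_null_le => //.
    + apply/lnullP; first exact: (@measurableD _ V).
      apply: lnull_sub (lnullU NB NB') _ => x [Bx nB'].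
      by have [Ex|nE] := pselect (E x); [right; left|left; right].
    + apply/lnullP; first exact: (@measurableD _ V).
      apply: lnull_sub (lnullU NB NB') _ => x [B'x nB].
      by have [Ex|nE] := pselect (E x); [left; left|right; right].
  apply: (@le_trans _ _ (Per s (E `\` U) U)).
    apply: Pmin; first by exists (B `\` U).
    by rewrite setDDl setUid.
  by apply: ereal_inf_lbound; exists (B `\` U).
split => //.
- by apply: lnull_sub NB _; exact: subsetUl.
- by apply/seteqP; split => // x [[_ nP] Px].
Qed.

Definition riesz_cut (N : nat) (z : 'rV[R]_m) : \bar R :=
  (Num.min (riesz s z) N%:R)%:E.

Lemma measurable_riesz_cut N : measurable_fun [set: V] (riesz_cut N).
Proof.
apply/measurable_EFinP; apply: measurable_minr => //.
exact: (measurableT_comp (measurable_powR (- (m%:R + s))) (@measurable_enorm R m)).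
Qed.

Definition riesz_cut_pair N (z : V * V) : \bar R :=
  riesz_cut N ((z.1 : 'rV[R]_m) - (z.2 : 'rV[R]_m))%R.

Lemma measurable_riesz_cut_pair N : measurable_fun setT (riesz_cut_pair N).
Proof. exact: (measurableT_comp (measurable_riesz_cut N) (@measurable_sub_pair R m)). Qed.

Lemma riesz_cut_ge0 N z : 0 <= riesz_cut N z.
Proof. by rewrite lee_fin le_min powR_ge0 ler0n. Qed.

(** Monotone convergence: [riesz] is real-valued everywhere, so at each pair the truncated kernels
    are eventually constant. *)
Lemma riesz_cut_lim_le (A D : set V) (N0 : nat) (c X : \bar R) :
  measurable A -> measurable D -> 0 <= c ->
  (forall N, (N0 <= N)%N -> interaction mu (riesz_cut_pair N) A D + c <= X) ->
  interaction mu (@riesz_pair R m s) A D + c <= X.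
Proof.
move=> mA mD c0 h.
have cvI : interaction mu (riesz_cut_pair N) A D @[N --> \oo] -->
    interaction mu (@riesz_pair R m s) A D.
  rewrite /interaction.
  have -> : \int[mu \x mu]_(z in A `*` D) riesz_pair s z =
      \int[mu \x mu]_(z in A `*` D) (limn (riesz_cut_pair ^~ z)).
    apply: eq_integral => z _; apply/esym/cvg_lim => //.
    apply: cvg_near_cst.
    exists (Num.truncn (riesz s ((z.1 : 'rV[R]_m) - (z.2 : 'rV[R]_m)))).+1 => // N /= hN.
    rewrite /riesz_cut_pair /riesz_cut /riesz_pair; congr EFin; apply/min_idPl; apply: ltW; apply: lt_le_trans (truncnS_gt _) _.
    by rewrite ler_nat.
  apply: cvg_monotone_convergence => //.
  - exact: measurableX.
  - by move=> N; apply: measurable_funTS; exact: measurable_riesz_cut_pair.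
  - by move=> N z _; exact: riesz_cut_ge0.
  - move=> z _ N N' NN'; rewrite lee_fin le_min ge_min lexx/= ge_min ler_nat NN' orbT//.
have cvIc : interaction mu (riesz_cut_pair N) A D + c @[N --> \oo] -->
    interaction mu (@riesz_pair R m s) A D + c.
  apply: cvgeD => //; last exact: cvg_cst.
  by apply: ge0_adde_def; rewrite inE// interaction_ge0// => z; exact: riesz_pair_ge0.
apply: (cvge_le _ cvIc); exists N0 => // N /= hN; exact: h.
Qed.

End Minimality.

(** * Conclusion *)

Section Cylinder.
Variable R : realType.

Lemma first_coordsB m (x y : 'rV[R]_m.+1) :
  first_coords (x - y) = first_coords x - first_coords y.
Proof. by apply/rowP => i; rewrite !mxE. Qed.

Lemma enormS m (x : 'rV[R]_m.+1) :
  enorm x ^+ 2 = enorm (first_coords x) ^+ 2 + last_coord x ^+ 2.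
Proof.
rewrite !enormE big_ord_recr/=; congr (_ + _).
by apply: eq_bigr => i _; rewrite mxE.
Qed.

Lemma enorm_first_le m (x : 'rV[R]_m.+1) : enorm (first_coords x) <= enorm x.
Proof.
rewrite -(@ler_pXn2r _ 2)// ?nnegrE ?enorm_ge0// enormS lerDl; exact: sqr_ge0.
Qed.

Lemma eopen_cylinder m (omega : set 'rV[R]_m) : eopen omega ->
  eopen [set X : 'rV[R]_m.+1 | omega (first_coords X)].
Proof.
move=> oo X /= /oo[r r0 rO]; exists r => // Y; rewrite /eball/= => YX.
by apply: rO; rewrite /eball/= -first_coordsB; exact: le_lt_trans (enorm_first_le _) YX.
Qed.

Lemma ebounded_eball m (p : 'rV[R]_m) r : ebounded (eball p r).
Proof.
exists (enorm p + r) => x; rewrite /eball/= => xp.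
by have := enormD p (x - p); rewrite addrC subrK; lra.
Qed.

Lemma eball_measure_fin m (p : 'rV[R]_m) r : 0 < r ->
  (row_measure R m (eball p r) < +oo)%E.
Proof.
move=> r0.
apply: (@le_lt_trans _ _ (row_measure R m [set x | forall i,
   (p ord0 i - r < (x : 'rV[R]_m) ord0 i < p ord0 i + r)%R])).
  apply: le_measure; rewrite ?inE.
  - by apply: eopen_measurable; exact: open_eball.
  - exact: measurable_open_box.
  move=> x /= xp i; have := le_lt_trans (coord_enorm (x - p) i) xp.
  by rewrite !mxE ltr_norml => /andP[? ?]; apply/andP; split; lra.
rewrite (@row_measure_box R m (fun i => p ord0 i - r)%R (fun i => p ord0 i + r)%R) ?ltry//.
by move=> i; lra.
Qed.

Lemma measurable_first_coords m :
  measurable_fun setT (@first_coords R m : rowspace R m.+1 -> rowspace R m).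
Proof.
apply: measurable_row => i; rewrite (_ : (fun _ => _) =
  fun x : rowspace R m.+1 => (x : 'rV[R]_m.+1) ord0 (widen_ord (leqnSn m) i)).
  exact: measurable_coord.
by apply/funext => x; rewrite mxE.
Qed.

(* Below the critical exponent the profile only gets steeper, so it suffices
   to treat the critical one. *)
Lemma critical_profile (c beta s a : R) : 0 < c -> 0 < beta <= s + 1 -> 0 <= a <= 1 ->
  Num.min c 1 * a `^ (1 + s) <= c * a `^ beta.
Proof.
move=> c0 /andP[b0 bs] /andP[a0 a1].
apply: ler_pM; rewrite ?powR_ge0 ?ge_min ?lexx//; first by rewrite le_min ltW/=.
have [->|aN0] := eqVneq a 0.
  by rewrite !powR0// gt_eqF//; lra.
by apply: ger_powR; [rewrite lt_def aN0 a0|rewrite addrC].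
Qed.

End Cylinder.

(** * Points of low level form a null set *)

Section Main.
Variables (R : realType) (n : nat) (s : R).
Local Notation V := (rowspace R n.+3).
Local Notation mu := (row_measure R n.+3).

(* index of the coordinate [x_n] *)
Definition xn_idx : 'I_n.+3 := widen_ord (leqnSn n.+2) ord_max.

Lemma xn_first (X : 'rV[R]_n.+3) : xn (first_coords X) = X ord0 xn_idx.
Proof. by rewrite /xn mxE. Qed.

Lemma xprime_first0 (X : 'rV[R]_n.+3) : xprime (first_coords X) ord0 ord0 = X ord0 ord0.
Proof. by rewrite !mxE; congr (X _ _); exact: val_inj. Qed.

Definition barrier_fun (X0 y : 'rV[R]_n.+3) : R :=
  (y - X0) ord0 xn_idx + enorm (y - X0) ^+ 2.

Lemma barrier_fun_le (X0 y : 'rV[R]_n.+3) : 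
  barrier_fun X0 y <= enorm (y - X0) + enorm (y - X0) ^+ 2.
Proof.
rewrite lerD2r; apply: le_trans (coord_enorm _ xn_idx); exact: ler_norm.
Qed.

Lemma measurable_barrier_fun X0 : measurable_fun setT (barrier_fun X0 : V -> R).
Proof.
apply: measurable_funD.
  exact: (measurableT_comp (@measurable_coord R n.+3 xn_idx) (measurable_row_translate X0)).
by apply: measurable_funX; exact: (measurableT_comp (@measurable_enorm R n.+3) (measurable_row_translate X0)).
Qed.

Lemma eopen_barrier X0 d : eopen [set y | barrier_fun X0 y < d].
Proof.
move=> y /= yd; set e := enorm (y - X0).
have e0 : 0 <= e by exact: enorm_ge0.
(* If [z] is within [q < 1] of [y], the linear part grows by at most [q] and the square by at most
   [q * (2 * e + 1)]. *)
pose t := Num.min 1 ((d - barrier_fun X0 y) / (2 * e + 3)).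
have e3 : 0 < 2 * e + 3 by lra.
exists t; first by rewrite lt_min ltr01 divr_gt0// subr_gt0.
move=> z; rewrite /eball/= => zy.
have zt1 : enorm (z - y) < 1 by apply: lt_le_trans zy _; rewrite ge_min lexx.
have zt2 : enorm (z - y) * (2 * e + 3) < d - barrier_fun X0 y.
  rewrite -ltr_pdivlMr//; apply: lt_le_trans zy _; rewrite ge_min lexx orbT//.
have := enormD (z - y) (y - X0); rewrite addrA subrK -/e => tri.
have := le_trans (ler_norm _) (coord_enorm (z - y) xn_idx).
move: zt2; rewrite /barrier_fun -/e !mxE.
have := enorm_ge0 (z - X0); have := enorm_ge0 (z - y).
move: (enorm (z - X0)) (enorm (z - y)) tri zt1 => p q tri q1 q0 p0.
have : p ^+ 2 <= (q + e) ^+ 2 by rewrite ler_pXn2r ?nnegrE//; lra.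
nra.
Qed.


(** Calibration gives the part [A] of [E] of low level an excess [mu A] of interaction with the
    complement over that with the rest of [E], and minimality forbids any excess. The hypotheses on
    [P] ensure that a lower point near [X0] is either deleted as well or in [P]. *)
Lemma minimal_barrier (E Om P : set 'rV[R]_n.+3) (X0 : 'rV[R]_n.+3)
    (r0 d0 d M : R) (Q : set V) :
  eopen Om -> s_minimal s E Om -> borel P -> P `&` E = set0 ->
  0 < r0 -> d <= d0 -> d <= (r0 / 2) ^+ 2 ->
  balanced xn_idx s (r0 / 2) d0 M Q ->
  (forall y, Q (y - X0) -> P y) ->
  (forall y, eball X0 r0 y -> ~ Om y -> P y) ->
  (forall y, Om y -> eball X0 r0 y -> 0 <= (y - X0) ord0 xn_idx) ->
  lnull (E `&` (Om `&` [set y | barrier_fun X0 y < d] `&` eball X0 r0)).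
Proof.
move=> oOm Emin bP PE r00 dd0 dr0 bal QP OmP Ompos.
set U := Om `&` _ `&` _.
have oU : eopen U.
  by apply: eopenI; [apply: eopenI => //; exact: eopen_barrier|exact: open_eball].
have bU : ebounded U.
  by have [K KP] := ebounded_eball X0 r0; exists K => x [_ /KP].
have UOm : U `<=` Om by move=> x [[]].
have mU : measurable (U : set V) by exact: eopen_measurable.
have [B [mB EB BP rem fin]] := minimal_removal bP mU PE (Emin U oU bU UOm).
have BnP x : B x -> ~ P x.
  by move=> Bx Px; have : (B `&` P) x by []; rewrite BP.
pose A : set V := B `&` U.
have mA : measurable A by exact: measurableI.
have Afin : (mu A < +oo)%E.
  apply: le_lt_trans (eball_measure_fin X0 r00); apply: le_measure; rewrite ?inE//.
    by apply: eopen_measurable; exact: open_eball.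
  by move=> x [_ []].
(* [P] is put below every leaf, which brings in the gain set. Restricting to the ball keeps lower
   points in [U] or in [P]. *)
pose W : set (V * V) := [set z | P z.2] `|`
  ([set z | barrier_fun X0 z.2 < barrier_fun X0 z.1] `&` [set z | eball X0 r0 z.2]).
have mW : measurable W.
  have m2 (S : set V) : measurable S -> measurable [set z : V * V | S z.2].
    move=> mS; rewrite -[X in measurable X]setTI; exact: (@measurable_snd _ _ V V).
  apply: measurableU; first exact: (m2 P).
  apply: measurableI.
    apply: measurable_ltr_set.
    - exact: (measurableT_comp (measurable_barrier_fun X0) measurable_snd).
    - exact: (measurableT_comp (measurable_barrier_fun X0) measurable_fst).
  by apply: m2; apply: eopen_measurable; exact: open_eball.
have WU x y : A x -> W (x, y) -> P y \/ U y.
  move=> [_ [[_ xd] _]] [Py|[/= yx yb]]; first by left.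
  have [Oy|nOy] := pselect (Om y); last by left; exact: OmP.
  by right; split => //; split => //; exact: lt_trans yx xd.
(* Both terms of the level are nonnegative on [Om], so the square of the distance is below [d].
   Hence the ball of radius [r0 / 2] about [x] stays in the ball about [X0], which explains the
   radius in [balanced]. *)
have Axr x : A x -> enorm (x - X0) < r0 / 2.
  move=> [_ [[Ox /= xd] xb]]; have x0 := Ompos x Ox xb.
  rewrite -(@ltr_pXn2r _ 2)// ?nnegrE ?enorm_ge0//; last by rewrite ltW// divr_gt0.
  apply: lt_le_trans dr0; apply: le_lt_trans xd; rewrite /barrier_fun.
  by rewrite lerDr.
have main N : M <= N%:R ->
    (interaction mu (@riesz_cut_pair R n.+3 s N) A (B `\` U) + mu A <=
     interaction mu (@riesz_pair R n.+3 s) A (~` B))%E.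
  move=> MN.
  apply: (@le_trans _ _ (interaction mu (@riesz_cut_pair R n.+3 s N) A (~` B))); last first.
    apply: ge0_le_integral => //.
    - by apply: measurableX => //; exact: measurableC.
    - by move=> z _; exact: riesz_cut_ge0.
    - by apply: measurable_funTS; exact: measurable_riesz_cut_pair.
    - by apply: measurable_funTS; exact: measurable_riesz_pair.
    - by move=> z _; rewrite lee_fin ge_min lexx.
  have kN z : riesz_cut s N (- z) = riesz_cut s N z :> \bar R.
    by rewrite /riesz_cut /riesz enormN.
  have kS x y : riesz_cut_pair s N (x, y) = riesz_cut s N ((y : 'rV[R]_n.+3) - x) :> \bar R.
    by rewrite /riesz_cut_pair -kN opprB.
  apply: (@calibration _ _ _ mu (@riesz_cut_pair R n.+3 s N) _ _ _ A (~` B) (B `\` U) W N%:R) => //.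
  - exact: measurable_riesz_cut_pair.
  - by move=> z; exact: riesz_cut_ge0.
  - exact: measurableC.
  - exact: measurableD.
  - by move=> z; rewrite lee_fin ge_min lexx orbT.
  - move=> x Ax; have xr := Axr x Ax; have [_ [[Ox /= xd] xb]] := Ax.
    have kSE S : (\int[mu]_(y in S) riesz_cut_pair s N (x, y) =
        \int[mu]_(y in S) riesz_cut s N ((y : 'rV[R]_n.+3) - x))%E.
      by apply: eq_integral => y _; rewrite kS.
    rewrite [X in (X + _)%E]kSE [leRHS]kSE.
    apply: (bal X0 x) => //.
    + exact: Ompos.
    + exact: lt_le_trans xd dd0.
    + exact: measurable_riesz_cut.
    + by move=> z; exact: riesz_cut_ge0.
    + by move=> z; rewrite lee_fin ge_min lexx.
    + by move=> z; rewrite lee_fin le_min ge_min lexx/= ge_min MN orbT.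
    + rewrite (_ : [set y | _] = xsection W x); first exact: measurable_xsection.
      by rewrite xsectionE.
    + by move=> y Qy; left; exact: QP.
    + move=> y yx yd; right; split => //=.
      have := enormD (y - x) (x - X0); rewrite addrA subrK /eball/=; lra.
  (* Points of [B] avoid [P], so between them [W] is a strict comparison of levels. *)
  - move=> x y [Bx _] [By _] [/= /(BnP y By)//|[/= yx _]] [/= /(BnP x Bx)//|[/= xy _]].
    by have := lt_trans yx xy; rewrite ltxx.
  - move=> x y Ax Wxy; have [Py|Uy] := WU x y Ax Wxy.
      by right => By; exact: BnP By Py.
    by have [By|nBy] := pselect (B y); [left|right].
  - move=> x y Ax [By nUy] Wxy; have [Py|//] := WU x y Ax Wxy.
    exact: BnP By Py.
  - by apply/seteqP; split => // x [[_ Ux] [_ nUx]].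
have A0 : mu A = 0%E.
  have mD : measurable (B `\` U) by exact: measurableD.
  have lim : (interaction mu (@riesz_pair R n.+3 s) A (B `\` U) + mu A <=
     interaction mu (@riesz_pair R n.+3 s) A (~` B))%E.
    apply: (@riesz_cut_lim_le R n.+3 s A (B `\` U) (Num.truncn M).+1) => // N hN.
    by apply: main; apply: ltW; apply: lt_le_trans (truncnS_gt M) _; rewrite ler_nat.
  have Ifin : interaction mu (@riesz_pair R n.+3 s) A (~` B) \is a fin_num.
    by rewrite ge0_fin_numE//; apply: interaction_ge0 => z; exact: riesz_pair_ge0.
  have : (interaction mu (@riesz_pair R n.+3 s) A (~` B) + mu A <=
     interaction mu (@riesz_pair R n.+3 s) A (~` B) + 0)%E.
    by rewrite adde0; apply: le_trans lim; exact: leeD.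
  by rewrite leeD2lE// measure_le0 => /eqP.
apply: (@lnull_sub R n.+3 _ ((E `\` B) `|` A)).
  by apply: lnullU => //; apply/(lnullP mA).
by move=> x [Ex Ux]; have [Bx|nBx] := pselect (B x); [right|left].
Qed.

End Main.

Lemma xprime_first (R : realType) m (x : 'rV[R]_m.+1) : xprime x = first_coords x.
Proof. by apply/rowP => i; rewrite !mxE; congr (x _ _); exact: val_inj. Qed.

Unset Implicit Arguments. Set Strict Implicit. Set Printing Implicit Defensive.

Theorem theorem1p3 (R : realType) (n : nat) (s : R)
  (omega : set 'rV[R]_n) (rho c beta : R)
  (phi : 'rV[R]_n.-1 -> R) (psi : 'rV[R]_n -> R) (E : set 'rV[R]_n.+1) :
  (2 <= n)%N -> 0 < s < 1 ->
  eopen omega -> ebounded omega ->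
  lipschitz_boundary [set X : 'rV[R]_n.+1 | omega (first_coords X)] ->
  0 < rho -> 0 < c -> 0 < beta <= s + 1 ->
  (forall x', 0 <= phi x') -> phi 0 = 0 ->
  (forall x', enorm x' < rho -> c * enorm x' `^ beta <= phi x') ->
  (forall x : 'rV[R]_n, enorm x < rho -> (omega x <-> phi (xprime x) < xn x)) ->
  Linfty_loc psi ->
  (forall x : 'rV[R]_n, enorm x < rho -> psi x <= 0) ->
  s_minimal s E [set X | omega (first_coords X)] ->
  E `\` [set X | omega (first_coords X)] =
    [set X | last_coord X < psi (first_coords X)] `\` [set X | omega (first_coords X)] ->
  (* normalization of E inside Omega: points of E have E-density > 0 *)
  (forall X, omega (first_coords X) -> E X ->
     forall r, 0 < r -> ~ lnull (E `&` eball X r)) ->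
  forall eps, 0 < eps -> exists2 delta, 0 < delta &
    forall X, E X -> enorm (first_coords X) < delta -> last_coord X <= eps.
Proof.
move=> n2 s01 oO _ _ rho0 c0 betas phi0 _ phic omphi _ psi0 Emin Eout dens eps eps0.
case: n omega phi psi E n2 oO phi0 phic omphi psi0 Emin Eout dens => [|[|n]]//
  omega phi psi E _ oO phi0 phic omphi psi0 Emin Eout dens.
have s0 : 0 < s by case/andP: s01.
(* The ball of radius [r0] about a point of the axis at height above [eps] projects into [B_rho] and
   stays above height [0], where [psi <= 0] excludes [E] outside the cylinder. *)
pose r0 : R := Num.min rho (Num.min eps 1).
have r00 : 0 < r0 by rewrite !lt_min rho0 eps0 ltr01.
have r0rho : r0 <= rho by rewrite ge_min lexx.
have r0eps : r0 <= eps by rewrite !ge_min lexx orbT.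
have r01 : r0 <= 1 by rewrite !ge_min lexx !orbT.
have c1 : 0 < Num.min c 1 <= 1 by rewrite lt_min c0 ltr01 ge_min lexx orbT.
(* Coordinates below [lam0] give a horizontal norm below [r0], so the gain boxes project into
   [B_rho]. *)
pose lam0 : R := r0 / (2 * n.+3%:R).
have n3 : 1 <= n.+3%:R :> R by rewrite ler1n.
have lam0E : lam0 * (2 * n.+3%:R) = r0 by rewrite /lam0 divfK// gt_eqF//; lra.
have lam0_gt0 : 0 < lam0 by rewrite divr_gt0//; lra.
have lam01 : 0 < lam0 <= 1 by rewrite lam0_gt0 /=; nra.
(* This is where [2 <= n] enters: [x'] has at least one coordinate, and the first one measures its
   size in the gain boxes. *)
have ij : (ord0 : 'I_n.+3) != xn_idx n by [].
have rb : 0 < r0 / 2 <= 1 by apply/andP; split; lra.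
have [d0 [M [Q [d00 mQ QP bal]]]] := barrier_balance ij s01 rb c1 lam01.
pose d : R := Num.min d0 ((r0 / 2) ^+ 2).
have dgt0 : 0 < d by rewrite lt_min d00 exprn_gt0//; lra.
(* With [X0] at the height of [X], the distance [t] from [X] to [X0] is horizontal and below [1], so
   the level of [X] is at most [t + t ^+ 2 <= 2 * t < d]. *)
exists (Num.min (d / 2) (r0 / 2)); first by rewrite lt_min !divr_gt0.
move=> X EX; rewrite lt_min => /andP[Xd Xr].
set Om : set 'rV[R]_n.+3 := [set X | omega (first_coords X)] in Emin Eout.
have EnO Y : E Y -> ~ omega (first_coords Y) -> last_coord Y < psi (first_coords Y).
  by move=> EY nOY; have : (E `\` Om) Y by []; rewrite Eout => -[].
have [OX|nOX] := pselect (omega (first_coords X)); last first.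
  apply: ltW; apply: lt_le_trans (EnO X EX nOX) _.
  by apply: le_trans (ltW eps0); apply: psi0; lra.
rewrite leNgt; apply/negP => Xeps; set h := last_coord X in Xeps.
pose X0 : 'rV[R]_n.+3 := \row_i (if i == ord_max then h else 0).
have X0max i : i != ord_max -> X0 ord0 i = 0 by move=> /negbTE h'; rewrite mxE h'.
have X0last : last_coord X0 = h by rewrite /last_coord mxE eqxx.
have X0first : first_coords X0 = 0.
  apply/rowP => i; rewrite !mxE; case: eqP => // /(congr1 val) /= ii.
  by have := ltn_ord i; rewrite ii ltnn.
have firstX0 (y : 'rV[R]_n.+3) : first_coords (y - X0) = first_coords y.
  by rewrite first_coordsB X0first subr0.
have lastX0 (y : 'rV[R]_n.+3) : last_coord (y - X0) = last_coord y - h.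
  by rewrite -X0last /last_coord !mxE.
have xnX0 (y : 'rV[R]_n.+3) : (y - X0) ord0 (xn_idx n) = xn (first_coords y).
  by rewrite -firstX0 xn_first.
pose P : set 'rV[R]_n.+3 :=
  [set y | [/\ ~ omega (first_coords y), enorm (first_coords y) < rho & 0 < last_coord y]].
have bP : borel P.
  rewrite (_ : P = (~` Om) `&` ([set y | enorm (first_coords y) < rho] `&`
      [set y | 0 < last_coord y])); last first.
    by apply/seteqP; split => y; [case|case=> ? []].
  apply: (@measurableI _ (rowspace R n.+3)).
    apply: (@measurableC _ (rowspace R n.+3)).
    by apply: eopen_measurable; exact: eopen_cylinder.
  apply: (@measurableI _ (rowspace R n.+3)).
    apply: measurable_ltr_set => //.
    exact: (measurableT_comp (@measurable_enorm R n.+2) (@measurable_first_coords R n.+2)).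
  by apply: measurable_ltr_set => //; exact: measurable_coord.
have PE : P `&` E = set0.
  apply/seteqP; split => // y [[nOy yrho yl] Ey].
  by have := EnO y Ey nOy; have := psi0 _ yrho; lra.
have key : lnull (E `&` (Om `&` [set y | barrier_fun X0 y < d] `&` eball X0 r0)).
  apply: (@minimal_barrier R n s E Om P X0 r0 d0 d M Q) => //.
  - exact: eopen_cylinder.
  - by rewrite ge_min lexx.
  - by rewrite ge_min lexx orbT.
  - move=> y Qy; have [yb _ yphi] := QP _ Qy.
    have fy : enorm (first_coords y) < r0.
      rewrite -firstX0; apply: (@le_lt_trans _ _ (n.+2%:R * lam0)).
        apply: enorm_lt_coord => // i; rewrite mxE.
        by have /andP[? ?] := yb (widen_ord (leqnSn n.+2) i); rewrite gtr0_norm.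
      have n23 : n.+3%:R = n.+2%:R + 1 :> R by rewrite natr1.
      by rewrite -lam0E n23; nra.
    have frho : enorm (first_coords y) < rho by lra.
    split => //; last first.
      have := yb ord_max; rewrite -[X in _ < X < _]/(last_coord (y - X0)) lastX0; lra.
    (* A gain point lies under the graph of [phi]: its [x_n] is below [Num.min c 1 * t^(1 + s)] with
       [t] the first coordinate, [t <= |x'|], and [critical_profile] passes to the exponent
       [beta]. *)
    move=> Oy; have /(omphi _ frho) := Oy.
    apply/negP; rewrite -leNgt -xnX0; apply: ltW; apply: lt_le_trans yphi _.
    set w := xprime (first_coords y).
    have wf : enorm w <= enorm (first_coords y).
      by rewrite /w xprime_first; exact: enorm_first_le.
    have w0 := enorm_ge0 w.
    apply: le_trans (phic w _); last by lra.
    apply: le_trans (critical_profile c0 betas _); last by rewrite w0 /=; lra.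
    rewrite ler_pM2l; last by case/andP: c1.
    apply: ge0_ler_powR; rewrite ?nnegrE//; first by lra.
      by have /andP[/ltW] := yb ord0.
    have -> : (y - X0) ord0 ord0 = w ord0 ord0.
      by rewrite -xprime_first0 firstX0.
    by apply: le_trans (coord_enorm w ord0); exact: ler_norm.
  - move=> y; rewrite /eball/= => yr nOy.
    have fy : enorm (first_coords y) < r0.
      by rewrite -firstX0; exact: le_lt_trans (enorm_first_le _) yr.
    split => //; first by lra.
    have := le_lt_trans (coord_enorm (y - X0) ord_max) yr.
    rewrite -/(last_coord (y - X0)) lastX0 ltr_norml => /andP[? _]; lra.
  - move=> y Oy; rewrite /eball/= => yr; rewrite xnX0.
    have fy : enorm (first_coords y) < rho.
      rewrite -firstX0; have := enorm_first_le (y - X0); lra.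
    by have /(omphi _ fy) := Oy; have := phi0 (xprime (first_coords y)); lra.
have XX0 : enorm (X - X0) = enorm (first_coords X).
  apply/eqP; rewrite -(@eqrXn2 _ 2)// ?enorm_ge0//.
  by rewrite enormS firstX0 lastX0 subrr expr0n addr0.
have oU : eopen (Om `&` [set y | barrier_fun X0 y < d] `&` eball X0 r0).
  apply: eopenI; last exact: open_eball.
  by apply: eopenI; [exact: eopen_cylinder|exact: eopen_barrier].
have [|r rpos rU] := oU X.
  have e0 := enorm_ge0 (first_coords X).
  split; last by rewrite /eball/= XX0; lra.
  split => //=; apply: le_lt_trans (barrier_fun_le X0 X) _; rewrite XX0; nra.
(* A whole ball about [X] lies in the open set where [E] is null, against positive density at
   [X]. *)
apply: (dens X OX EX r rpos); apply: lnull_sub key _.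
by move=> y [Ey yr]; split => //; exact: rU.
Qed.
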